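(* Let $S=\{r,r+1,\dots,n\}$ be a finite subset of $\mathbb{Z}$ with $r\le n$, and let $\lambda,\mu\in P_+(S)$. Then $L(S,\lambda)\otimes L(S,\mu)$ is a cyclic $\mathfrak{gl}_\infty$-module (generated by a single vector). Furthermore, there exists an integer $k$ with $k\ge n$ such that for any integer $\bar n\ge k$, setting $\bar S=\{r,r+1,\dots,\bar n\}$, the decomposition of $L(S,\lambda)\otimes L(S,\mu)$ into irreducible $\mathfrak{gl}_\infty$-submodules agrees with the decomposition of $L(\lambda_{\bar S})\otimes L(\mu_{\bar S})$ into irreducible $\mathfrak{gl}_{\bar S}$-submodules; that is, if $L(\lambda_{\bar S})\otimes L(\mu_{\bar S})\simeq\bigoplus_{\alpha\in I}L(\nu^\alpha_{\bar S})$ as a $\mathfrak{gl}_{\bar S}$-module, with $\nu^\alpha\in H^*$, $\mathrm{supp}(\nu^\alpha)\subset\bar S$, then $L(S,\lambda)\otimes L(S,\mu)\simeq\bigoplus_{\alpha\in I}L(\bar S,\nu^\alpha)$ as a $\mathfrak{gl}_\infty$-module.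
   Context: All vector spaces are over $\mathbb{C}$; $\mathbb{N}=\{0,1,2,\dots\}$. $\mathfrak{gl}_\infty$ is the Lie algebra of doubly infinite matrices (indexed by $\mathbb{Z}\times\mathbb{Z}$) with finitely many nonzero entries, with basis the matrix units $E_{m,n}$ ($m,n\in\mathbb{Z}$) and $[E_{m,n},E_{r,s}]=\delta_{n,r}E_{m,s}-\delta_{m,s}E_{r,n}$. $H=\mathrm{span}\{E_{n,n}: n\in\mathbb{Z}\}$. For a finite nonempty $S\subset\mathbb{Z}$ put $\mathfrak{gl}_S=\mathrm{span}\{E_{m,n}: m,n\in S\}$, $H_S=\mathrm{span}\{E_{n,n}:n\in S\}$, $\mathfrak{gl}_\infty^{(S,+)}=\mathrm{span}\{E_{m,n}: m\in\mathbb{Z},\ n\notin S\}$. For a $\mathfrak{gl}_S$-module $U$, let $\mathfrak{gl}_\infty^{(S,+)}$ act trivially on $U$, and set $M(S,U)=U(\mathfrak{gl}_\infty)\otimes_{U(\mathfrak{gl}_\infty^{(S,+)}+\mathfrak{gl}_S)}U$. If $U$ is irreducible, $M(S,U)$ has a unique irreducible quotient. For $\lambda\in H^*$, $\mathrm{supp}(\lambda)=\{m\in\mathbb{Z}:\lambda(E_{m,m})\neq 0\}$. If $\mathrm{supp}(\lambda)\subset S$, let $\lambda_S=\lambda|_{H_S}$ and let $L(\lambda_S)$ be the irreducible highest weight $\mathfrak{gl}_S$-module of highest weight $\lambda_S$ with respect to the positive part $\mathrm{span}\{E_{m,n}: m,n\in S,\ m<n\}$. $L(S,\lambda)$ is the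 irreducible quotient of $M(S,L(\lambda_S))$. $P_+(S)$ is the set of $\lambda\in H^*$ such that $\lambda(E_{i,i})\in\mathbb{N}$ for all $i\in\mathbb{Z}$, $\lambda(E_{i,i})=0$ whenever $i\notin S$, and $\lambda(E_{i,i})\ge\lambda(E_{j,j})$ for all $i,j\in S$ with $i<j$. *)

(* Defs.v *)
From HB Require Import structures.
From mathcomp Require Import all_boot all_order all_algebra.
From mathcomp Require Import finmap monalg.
From mathcomp Require Import boolp classical_sets cardinality.
From mathcomp Require Import reals complex.
Set Implicit Arguments.
Unset Strict Implicit.
Unset Printing Implicit Defensive.
Import Order.TTheory GRing.Theory Num.Theory.
Local Open Scope ring_scope.
Local Open Scope quotient_scope.

Section FreeModule.
Context {K : fieldType} {X : choiceType}.

Section Extension.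
Context {V : lmodType K} (f : X -> V).

Definition malg_ext (a : {malg K[X]}) : V := \sum_(k <- msupp a) a@_k *: f k.

Lemma malg_extEw (d : {fset X}) a : (msupp a `<=` d)%fset ->
  malg_ext a = \sum_(k <- d) a@_k *: f k.
Proof.
move=> le; rewrite /malg_ext (big_fset_incl _ le) // => k _ kN.
by rewrite mcoeff_outdom // scale0r.
Qed.

Lemma malg_ext_is_linear : linear malg_ext.
Proof.
move=> c a b; pose d := (msupp a `|` msupp b)%fset.
rewrite (@malg_extEw d a) ?fsubsetUl // (@malg_extEw d b) ?fsubsetUr //.
rewrite (@malg_extEw d); last first.
  apply: fsubset_trans (msuppD_le _ _) _.
  by apply: fsetSU; apply: msuppZ_le.
rewrite scaler_sumr -big_split /=; apply: eq_bigr => k _.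
by rewrite mcoeffD mcoeffZ scalerDl scalerA.
Qed.

HB.instance Definition _ :=
  GRing.isLinear.Build K {malg K[X]} V *:%R malg_ext malg_ext_is_linear.

Lemma malg_extU x : malg_ext << x >> = f x.
Proof.
by rewrite (malg_extEw (d := [fset x]%fset)) ?msuppU_le // big_seq_fset1
  mcoeffUU scale1r.
Qed.

End Extension.

Lemma malgUZ a (x : X) : << a *g x >> = a *: << x >> :> {malg K[X]}.
Proof. by apply/malgP => i; rewrite mcoeffZ !mcoeffU mulrnAr mulr1. Qed.

Lemma malg_linear_eq (V : lmodType K) (f g : {linear {malg K[X]} -> V}) :
  (forall x, f << x >> = g << x >>) -> f =1 g.
Proof.
move=> fg a; rewrite (monalgE a) !linear_sum; apply: eq_bigr => k _.
by rewrite malgUZ !linearZ_LR fg.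
Qed.

Lemma malg_ind (P : {malg K[X]} -> Prop) : P 0 ->
  (forall a u v, P u -> P v -> P (a *: u + v)) -> (forall x, P << x >>) ->
  forall u, P u.
Proof.
move=> P0 PD PU u; rewrite (monalgE u); elim: (enum_fset _) => [|k s IH].
  by rewrite big_nil.
by rewrite big_cons malgUZ; apply: PD.
Qed.

Lemma malg_extD (V : lmodType K) (f g : X -> V) u :
  malg_ext (fun x => f x + g x) u = malg_ext f u + malg_ext g u.
Proof.
by rewrite -big_split; apply: eq_bigr => k _; rewrite scalerDr.
Qed.

Lemma malg_extZ (V : lmodType K) (f : X -> V) a u :
  malg_ext (fun x => a *: f x) u = a *: malg_ext f u.
Proof.
rewrite scaler_sumr; apply: eq_bigr => k _.
by rewrite !scalerA mulrC.
Qed.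

Lemma eq_malg_ext (V : lmodType K) (f g : X -> V) : f =1 g -> 
  malg_ext f =1 malg_ext g.
Proof. by move=> fg u; apply: eq_bigr => k _; rewrite fg. Qed.

End FreeModule.

Section Subspace.
Context {K : fieldType}.

Record subspace (V : lmodType K) := Subspace {
  subspace_set :> V -> Prop;
  subspace0 : subspace_set 0;
  subspaceP : forall a u v,
    subspace_set u -> subspace_set v -> subspace_set (a *: u + v) }.

Section Theory.
Context {V : lmodType K} (N : subspace V).

Lemma subspaceD u v : N u -> N v -> N (u + v).
Proof. by move=> /(subspaceP 1) /[apply]; rewrite scale1r. Qed.

Lemma subspaceZ a u : N u -> N (a *: u).
Proof. by move=> Nu; rewrite -[_ *: _]addr0; apply: subspaceP (subspace0 _). Qed.

Lemma subspaceN u : N u -> N (- u).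
Proof. by move=> /(subspaceZ (-1)); rewrite scaleN1r. Qed.

Lemma subspaceB u v : N u -> N v -> N (u - v).
Proof. by move=> Nu /subspaceN; apply: subspaceD. Qed.
End Theory.

Section Span.
Context {V : lmodType K} (X : V -> Prop).

Definition span_set (v : V) : Prop :=
  forall N : subspace V, (forall x, X x -> N x) -> N v.

Fact span0 : span_set 0. Proof. by move=> N _; apply: subspace0. Qed.
Fact spanP a u v : span_set u -> span_set v -> span_set (a *: u + v).
Proof. by move=> su sv N XN; apply: subspaceP; [apply: su|apply: sv]. Qed.

Definition span : subspace V := Subspace span0 spanP.

Lemma sub_span v : X v -> span v. Proof. by move=> Xv N; apply. Qed.
End Span.

Section Preim.
Context {V W : lmodType K} (f : {linear V -> W}) (N : subspace W).

Fact preim_sub0 : N (f 0). Proof. by rewrite linear0; apply: subspace0. Qed.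
Fact preim_subP a u v : N (f u) -> N (f v) -> N (f (a *: u + v)).
Proof. by rewrite linearP; apply: subspaceP. Qed.
Definition preim_sub : subspace V :=
  @Subspace V (fun v => N (f v)) preim_sub0 preim_subP.
End Preim.

Section Ker.
Context {V W : lmodType K} (f : {linear V -> W}).

Fact ker0 : f 0 = 0. Proof. exact: linear0. Qed.
Fact kerP a u v : f u = 0 -> f v = 0 -> f (a *: u + v) = 0.
Proof. by rewrite linearP => -> ->; rewrite scaler0 addr0. Qed.
Definition ker : subspace V := @Subspace V (fun v => f v = 0) ker0 kerP.
End Ker.

Section Quotient.
Context {V : lmodType K} (N : subspace V).

Definition quot_rel (u v : V) : bool := `[< N (u - v) >].

Fact quot_rel_refl : reflexive quot_rel.
Proof. by move=> u; apply/asboolP; rewrite subrr; apply: subspace0. Qed.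
Fact quot_rel_sym : symmetric quot_rel.
Proof.
move=> u v; apply/asboolP/asboolP => /subspaceN; by rewrite opprB.
Qed.
Fact quot_rel_trans : transitive quot_rel.
Proof.
move=> v u w /asboolP uv /asboolP vw; apply/asboolP.
by rewrite -[u](subrK v) -addrA; apply: subspaceD.
Qed.
Canonical quot_equiv := EquivRel quot_rel quot_rel_refl quot_rel_sym quot_rel_trans.

Definition quot := {eq_quot quot_rel}.
HB.instance Definition _ := Choice.on quot.
HB.instance Definition _ := EqQuotient.on quot.

Definition qpi (v : V) : quot := \pi_quot v.

Lemma qpiP u v : reflect (N (u - v)) (qpi u == qpi v).
Proof. by rewrite /qpi pi_eq_quot; apply: asboolP. Qed.

Lemma qpi_eq u v : N (u - v) -> qpi u = qpi v.
Proof. by move=> h; apply/eqP/qpiP. Qed.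

Lemma qreprK x : qpi (repr x) = x. Proof. exact: reprK. Qed.

Lemma qpi_repr v : N (repr (qpi v) - v).
Proof. by apply/qpiP; rewrite qreprK. Qed.

Lemma qpi_ind (P : quot -> Prop) : (forall v, P (qpi v)) -> forall x, P x.
Proof. by move=> h x; rewrite -[x]qreprK. Qed.

Definition qadd (x y : quot) := qpi (repr x + repr y).
Definition qopp (x : quot) := qpi (- repr x).
Definition qscale (a : K) (x : quot) := qpi (a *: repr x).

Let qpiD u v : qpi (u + v) = qadd (qpi u) (qpi v).
Proof.
apply/esym/qpi_eq; rewrite opprD addrACA.
by apply: subspaceD; apply: qpi_repr.
Qed.
Let qpiN u : qpi (- u) = qopp (qpi u).
Proof. by apply/esym/qpi_eq; rewrite -opprD; apply/subspaceN/qpi_repr. Qed.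
Let qpiZ a u : qpi (a *: u) = qscale a (qpi u).
Proof.
by apply/esym/qpi_eq; rewrite -scalerBr; apply/subspaceZ/qpi_repr.
Qed.

Fact qaddA : associative qadd.
Proof. by do 3 elim/qpi_ind=> ?; rewrite -!qpiD addrA. Qed.
Fact qaddC : commutative qadd.
Proof. by do 2 elim/qpi_ind=> ?; rewrite -!qpiD addrC. Qed.
Fact qadd0 : left_id (qpi 0) qadd.
Proof. by elim/qpi_ind=> ?; rewrite -!qpiD add0r. Qed.
Fact qaddN : left_inverse (qpi 0) qopp qadd.
Proof. by elim/qpi_ind=> ?; rewrite -qpiN -!qpiD addNr. Qed.

Fact qscaleA a b (v : quot) : qscale a (qscale b v) = qscale (a * b) v.
Proof. by elim/qpi_ind: v => v; rewrite -!qpiZ scalerA. Qed.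
Fact qscale1 : left_id 1 qscale.
Proof. by elim/qpi_ind => v; rewrite -!qpiZ scale1r. Qed.
Fact qscaleDr : right_distributive qscale qadd.
Proof.
by move=> a; do 2 elim/qpi_ind => ?; rewrite -qpiD -!qpiZ scalerDr qpiD.
Qed.
Fact qscaleDl (v : quot) : {morph qscale^~ v : a b / a + b >-> qadd a b}.
Proof. by elim/qpi_ind: v => v a b; rewrite -!qpiZ -qpiD scalerDl. Qed.
HB.instance Definition _ := GRing.isZmodule.Build quot qaddA qaddC qadd0 qaddN.

HB.instance Definition _ :=
  GRing.Zmodule_isLmodule.Build K quot qscaleA qscale1 qscaleDr qscaleDl.

Fact qpi_is_linear : linear qpi.
Proof. by move=> a u v; rewrite qpiD qpiZ. Qed.
HB.instance Definition _ := GRing.isLinear.Build K V quot *:%R qpi qpi_is_linear.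

Lemma qpi_eq0 v : N v -> qpi v = 0.
Proof. by move=> Nv; apply: qpi_eq; rewrite subr0. Qed.

(* The map induced on V / N by a linear map vanishing on N. *)
Section Lift.
Context {W : lmodType K} (f : {linear V -> W}).
Definition quot_lift (x : quot) : W := f (repr x).

Lemma quot_liftE : (forall v, N v -> f v = 0) -> forall v, quot_lift (qpi v) = f v.
Proof. by move=> f0 v; apply/eqP; rewrite -subr_eq0 -linearB f0 //; apply: qpi_repr. Qed.
End Lift.
End Quotient.
End Subspace.

Record ideal (K : fieldType) (A : algType K) := Ideal {
  ideal_sub :> subspace A;
  idealMl : forall a b, ideal_sub b -> ideal_sub (a * b);
  idealMr : forall a b, ideal_sub b -> ideal_sub (b * a);
  ideal_proper : ~ ideal_sub 1 }.

Section AlgebraQuotient.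
Context {K : fieldType} {A : algType K} (J : ideal A).

Definition aquot := quot J.
HB.instance Definition _ := GRing.Lmodule.on aquot.

Definition aqpi : A -> aquot := qpi J.
HB.instance Definition _ := GRing.Linear.on aqpi.

Definition aqmul (u v : aquot) : aquot := aqpi (repr u * repr v).

Let aqmulE a b : aqmul (aqpi a) (aqpi b) = aqpi (a * b).
Proof.
apply: qpi_eq; set a' := repr _; set b' := repr _.
have -> : a' * b' - a * b = (a' - a) * b' + a * (b' - b).
  by rewrite mulrBl mulrBr addrA subrK.
by apply: subspaceD; [apply: idealMr | apply: idealMl]; apply: qpi_repr.
Qed.

Lemma aqpi_ind (P : aquot -> Prop) : (forall a, P (aqpi a)) -> forall x, P x.
Proof. exact: qpi_ind. Qed.

Let aqpiD a b : aqpi (a + b) = aqpi a + aqpi b. Proof. exact: linearD. Qed.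
Let aqpiZ c a : aqpi (c *: a) = c *: aqpi a. Proof. exact: linearZ. Qed.

Fact aqmulA : associative aqmul.
Proof. by do 3 elim/aqpi_ind=> ?; rewrite !aqmulE mulrA. Qed.
Fact aqmul1r : left_id (aqpi 1) aqmul.
Proof. by elim/aqpi_ind=> ?; rewrite !aqmulE mul1r. Qed.
Fact aqmulr1 : right_id (aqpi 1) aqmul.
Proof. by elim/aqpi_ind=> ?; rewrite !aqmulE mulr1. Qed.
Fact aqmulDl : left_distributive aqmul +%R.
Proof. by do 3 elim/aqpi_ind=> ?; rewrite -aqpiD !aqmulE mulrDl -aqpiD. Qed.
Fact aqmulDr : right_distributive aqmul +%R.
Proof. by do 3 elim/aqpi_ind=> ?; rewrite -aqpiD !aqmulE mulrDr -aqpiD. Qed.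
Fact aqoner_neq0 : aqpi 1 != 0.
Proof.
apply/negP; rewrite -(linear0 aqpi) => /qpiP.
by rewrite subr0; apply: ideal_proper.
Qed.
HB.instance Definition _ := GRing.Zmodule_isNzRing.Build aquot
  aqmulA aqmul1r aqmulr1 aqmulDl aqmulDr aqoner_neq0.

Lemma aqpiM a b : aqpi (a * b) = aqpi a * aqpi b.
Proof. by rewrite -aqmulE. Qed.

Lemma aqpi1 : aqpi 1 = 1. Proof. by []. Qed.

Fact aqscaleAl c (u v : aquot) : c *: (u * v) = (c *: u) * v.
Proof.
elim/aqpi_ind: u => u; elim/aqpi_ind: v => v.
by rewrite -aqpiM -!aqpiZ scalerAl aqpiM.
Qed.
HB.instance Definition _ := GRing.Lmodule_isLalgebra.Build K aquot aqscaleAl.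

Fact aqscaleAr c (u v : aquot) : c *: (u * v) = u * (c *: v).
Proof.
elim/aqpi_ind: u => u; elim/aqpi_ind: v => v.
by rewrite -aqpiM -!aqpiZ scalerAr aqpiM.
Qed.
HB.instance Definition _ := GRing.Lalgebra_isAlgebra.Build K aquot aqscaleAr.
End AlgebraQuotient.

HB.mixin Record Lmodule_isLieAlgebra (K : fieldType) L of GRing.Lmodule K L := {
  bracket : L -> L -> L;
  bracketDl : forall a (x y z : L),
    bracket (a *: x + y) z = a *: bracket x z + bracket y z;
  bracketDr : forall a (x y z : L),
    bracket x (a *: y + z) = a *: bracket x y + bracket x z;
  bracketxx : forall x : L, bracket x x = 0;
  jacobi : forall x y z : L,
    bracket x (bracket y z) + bracket y (bracket z x)
    + bracket z (bracket x y) = 0 }.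

#[short(type="lieAlgType")]
HB.structure Definition LieAlgebra (K : fieldType) :=
  {L of GRing.Lmodule K L & Lmodule_isLieAlgebra K L}.

HB.mixin Record Lmodule_isLieModule (K : fieldType) (L : lieAlgType K) V
    of GRing.Lmodule K V := {
  act : L -> V -> V;
  actDl : forall a (x y : L) (v : V), act (a *: x + y) v = a *: act x v + act y v;
  actDr : forall a (x : L) (u v : V), act x (a *: u + v) = a *: act x u + act x v;
  act_bracket : forall (x y : L) (v : V),
    act (bracket x y) v = act x (act y v) - act y (act x v) }.

#[short(type="lieModType")]
HB.structure Definition LieModule (K : fieldType) (L : lieAlgType K) :=
  {V of GRing.Lmodule K V & Lmodule_isLieModule K L V}.

HB.instance Definition _ (K : fieldType) (L : lieAlgType K) (V : lieModType L)
  (x : L) := GRing.isLinear.Build K V V *:%R (act x) (fun a => actDr a x).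

Section LieSubalgebra.
Context {K : fieldType} {L : lieAlgType K}.

Record lieSub := LieSub {
  lieSub_pred : {pred L};
  lieSub_submod : submod_closed lieSub_pred;
  lieSub_bracket : forall x y,
    x \in lieSub_pred -> y \in lieSub_pred -> bracket x y \in lieSub_pred }.

Context (P : lieSub).

HB.instance Definition _ := GRing.isSubmodClosed.Build K L (lieSub_pred P)
  (GRing.submod_closed_semi (lieSub_submod P)).

Record lieSub_type : predArgType := LieSubEl {
  lsval :> L; lsvalP : lsval \in lieSub_pred P }.

HB.instance Definition _ := [isSub of lieSub_type for lsval].
HB.instance Definition _ := [Choice of lieSub_type by <:].
HB.instance Definition _ := [SubChoice_isSubLmodule of lieSub_type by <:].

Definition lsbracket (x y : lieSub_type) : lieSub_type :=
  LieSubEl (lieSub_bracket (lsvalP x) (lsvalP y)).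

Fact lsbracketDl a x y z :
  lsbracket (a *: x + y) z = a *: lsbracket x z + lsbracket y z.
Proof. by apply/val_inj/bracketDl. Qed.
Fact lsbracketDr a x y z :
  lsbracket x (a *: y + z) = a *: lsbracket x y + lsbracket x z.
Proof. by apply/val_inj/bracketDr. Qed.
Fact lsbracketxx x : lsbracket x x = 0.
Proof. exact/val_inj/bracketxx. Qed.
Fact lsjacobi x y z :
  lsbracket x (lsbracket y z) + lsbracket y (lsbracket z x)
  + lsbracket z (lsbracket x y) = 0.
Proof. exact/val_inj/jacobi. Qed.

HB.instance Definition _ := Lmodule_isLieAlgebra.Build K lieSub_type
  lsbracketDl lsbracketDr lsbracketxx lsjacobi.
End LieSubalgebra.
Arguments lieSub {K} L.
Coercion lieSub_type : lieSub >-> predArgType.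

(* The commutator of an associative bilinear product is a Lie bracket. *)
Section Commutator.
Context {K : fieldType} {A : lmodType K} (mul : A -> A -> A).
Hypothesis mulDl : forall a x y z, mul (a *: x + y) z = a *: mul x z + mul y z.
Hypothesis mulDr : forall a x y z, mul x (a *: y + z) = a *: mul x y + mul x z.

Fact comm_mul0x x : mul 0 x = 0.
Proof. by have := mulDl (-1) 0 0 x; rewrite scaler0 addr0 scaleN1r addNr. Qed.
Fact comm_mulx0 x : mul x 0 = 0.
Proof. by have := mulDr (-1) x 0 0; rewrite scaler0 addr0 scaleN1r addNr. Qed.

Fact comm_bracketDl a x y z : mul (a *: x + y) z - mul z (a *: x + y)
  = a *: (mul x z - mul z x) + (mul y z - mul z y).
Proof. by rewrite mulDl mulDr scalerBr opprD addrACA. Qed.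

Fact comm_bracketDr a x y z : mul x (a *: y + z) - mul (a *: y + z) x
  = a *: (mul x y - mul y x) + (mul x z - mul z x).
Proof. by rewrite mulDl mulDr scalerBr opprD addrACA. Qed.

Fact comm_jacobi : associative mul -> forall x y z,
  mul x (mul y z - mul z y) - mul (mul y z - mul z y) x +
  (mul y (mul z x - mul x z) - mul (mul z x - mul x z) y) +
  (mul z (mul x y - mul y x) - mul (mul x y - mul y x) z) = 0.
Proof.
move=> mulA x y z.
have Bl u v w : mul (u - v) w = mul u w - mul v w.
  by rewrite -[- v]scaleN1r addrC mulDl scaleN1r addrC.
have Br u v w : mul w (u - v) = mul w u - mul w v.
  by rewrite -[- v]scaleN1r addrC mulDr scaleN1r addrC.
have reorder (a b c d : A) : a - b - (c - d) = (a + d) - (b + c).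
  by rewrite opprB addrACA -opprD.
rewrite !Bl !Br !mulA !reorder [mul (mul y z) x + _]addrC subrKA.
by rewrite [mul (mul z x) y + _]addrC subrKA [X in _ - X]addrC subrr.
Qed.

Fact comm_mulA (e : int -> int -> A) :
  (forall P : A -> Prop, P 0 ->
    (forall a u v, P u -> P v -> P (a *: u + v)) -> (forall m n, P (e m n)) ->
    forall u, P u) ->
  (forall m n r s, mul (e m n) (e r s) = if n == r then e m s else 0) ->
  associative mul.
Proof.
move=> ind mulE x y z; elim/ind: x => [|a x x' Hx Hx'|m n].
- by rewrite !comm_mul0x.
- by rewrite !mulDl Hx Hx'.
elim/ind: y => [|a y y' Hy Hy'|r s].
- by rewrite !(comm_mul0x, comm_mulx0).
- by rewrite !(mulDl, mulDr) Hy Hy'.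
elim/ind: z => [|a z z' Hz Hz'|u v].
- by rewrite !comm_mulx0.
- by rewrite !mulDr Hz Hz'.
rewrite !mulE; case nr: (n == r); case su: (s == u);
  by rewrite ?comm_mul0x ?comm_mulx0 ?mulE ?nr ?su.
Qed.
End Commutator.

(* gl_oo: the matrix with coefficients x@_(m, n) is encoded as the formal
   combination x of the matrix units gE m n := << (m, n) >>. *)
Definition glinf (K : fieldType) := {malg K[(int * int)%type]}.
HB.instance Definition _ K := GRing.Lmodule.on (glinf K).

HB.lock Definition gE (K : fieldType) (m n : int) : glinf K := << (m, n) >>.
Arguments gE {K} m n.

HB.lock Definition glmul (K : fieldType) (x y : glinf K) : glinf K :=
  malg_ext (fun p => malg_ext (fun q => if p.2 == q.1 then gE p.1 q.2 else 0) y) x.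

Section GlInf.
Context {K : fieldType}.
Implicit Types x y z : glinf K.

Lemma gl_ind (P : glinf K -> Prop) : P 0 ->
  (forall a u v, P u -> P v -> P (a *: u + v)) -> (forall m n, P (gE m n)) ->
  forall u, P u.
Proof.
move=> P0 PD PE; apply: malg_ind => // -[m n].
by have := PE m n; rewrite gE.unlock.
Qed.

Lemma glmulE m n r s :
  glmul (gE m n) (gE r s) = if n == r then gE m s else 0 :> glinf K.
Proof. by rewrite glmul.unlock [in gE m n]gE.unlock [in gE r s]gE.unlock !malg_extU. Qed.

Lemma glmulDl a x y z : glmul (a *: x + y) z = a *: glmul x z + glmul y z.
Proof. by rewrite glmul.unlock; exact: linearP. Qed.

Lemma glmulDr a x y z : glmul x (a *: y + z) = a *: glmul x y + glmul x z.
Proof.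
rewrite glmul.unlock -malg_extZ -malg_extD.
by apply: eq_malg_ext => p; rewrite linearP.
Qed.

Lemma glmul0x x : glmul 0 x = 0. Proof. by have := glmulDl (-1) 0 0 x; rewrite scaler0 addr0 scaleN1r addNr. Qed.
Lemma glmulx0 x : glmul x 0 = 0.
Proof. by have := glmulDr (-1) x 0 0; rewrite scaler0 addr0 scaleN1r addNr. Qed.

Lemma glmulA : associative (@glmul K).
Proof. exact: (comm_mulA glmulDl glmulDr gl_ind glmulE). Qed.

Definition glbracket (x y : glinf K) : glinf K := glmul x y - glmul y x.

Lemma glbracketE m n r s : glbracket (gE m n) (gE r s) =
  (if n == r then gE m s else 0) - (if m == s then gE r n else 0).
Proof. by rewrite /glbracket (glmulE m n) (glmulE r s) [m == s]eq_sym. Qed.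

Fact glbracketxx x : glbracket x x = 0. Proof. exact: subrr. Qed.

HB.instance Definition _ := Lmodule_isLieAlgebra.Build K (glinf K)
  (comm_bracketDl glmulDl glmulDr) (comm_bracketDr glmulDl glmulDr)
  glbracketxx (comm_jacobi glmulDl glmulDr glmulA).
End GlInf.

(* the span of the matrix units gE m n such that P m n *)
HB.lock Definition glspan (K : fieldType) (P : rel int) : {pred glinf K} :=
  fun x => all (fun p => P p.1 p.2) (msupp x).
Arguments glspan {K} P.

Section GlSub.
Context {K : fieldType}.
Implicit Types (P : rel int) (S : {pred int}) (x y : glinf K).

Lemma glspanP P x : reflect (forall m n, x@_(m, n) != 0 -> P m n) (x \in glspan P).
Proof.
rewrite glspan.unlock; apply: (iffP allP) => [h m n|h [m n]].
  by rewrite mcoeff_neq0 => /h.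
by rewrite -mcoeff_neq0 => /h.
Qed.

Lemma glspan_submod P : submod_closed (@glspan K P).
Proof.
split=> [|a x y /glspanP Px /glspanP Py]; apply/glspanP => m n.
  by rewrite mcoeff0 eqxx.
rewrite mcoeffD mcoeffZ => nz.
have [x0|/Px//] := eqVneq x@_(m, n) 0; have [y0|/Py//] := eqVneq y@_(m, n) 0.
by rewrite x0 y0 mulr0 addr0 eqxx in nz.
Qed.

Lemma glspanD P a x y :
  x \in glspan P -> y \in glspan P -> a *: x + y \in glspan P.
Proof. by case: (glspan_submod P) => _ PD Px Py; apply: (PD a x y Px Py). Qed.

Lemma glspan0 P : (0 : glinf K) \in glspan P.
Proof. by case: (glspan_submod P). Qed.

Lemma glspan_E P m n : P m n -> @gE K m n \in glspan P.
Proof.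
move=> Pmn; apply/glspanP => i j.
by rewrite gE.unlock mcoeffU; case: ((m, n) =P (i, j)) => [[<- <-]|_] //; rewrite mulr0n eqxx.
Qed.

Lemma glspan_ind P (Q : glinf K -> Prop) : Q 0 ->
  (forall a u v, Q u -> Q v -> Q (a *: u + v)) ->
  (forall m n, P m n -> Q (gE m n)) -> forall x, x \in glspan P -> Q x.
Proof.
move=> Q0 QD QE x; rewrite glspan.unlock => /allP Px.
rewrite (monalgE x) big_seq.
apply: (big_ind Q) => // [u v Qu Qv|[m n] /Px /= /QE].
  by rewrite -[u]scale1r; apply: QD.
by rewrite gE.unlock malgUZ -[_ *: _]addr0 => Qmn; apply: QD.
Qed.

Lemma glspan_mul P x y : transitive P ->
  x \in glspan P -> y \in glspan P -> glmul x y \in glspan P.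
Proof.
move=> trP Px Py.
elim/(@glspan_ind P): Px => [|a u v Pu Pv|m n Pmn].
- by rewrite (glmul0x y); exact: glspan0.
- by rewrite (glmulDl a u v y); exact: glspanD.
elim/(@glspan_ind P): Py => [|a u v Pu Pv|r s Prs].
- by rewrite (glmulx0 (gE m n)); exact: glspan0.
- by rewrite (glmulDr a (gE m n) u v); exact: glspanD.
rewrite (glmulE m n r s); case: eqP => nr; last exact: glspan0.
by apply: glspan_E; apply: trP Pmn _; rewrite nr.
Qed.

Lemma glspan_bracket P : transitive P -> forall x y,
  x \in glspan P -> y \in glspan P -> bracket x y \in glspan P.
Proof.
move=> trP x y Px Py; rewrite /bracket/= /glbracket addrC -[- _]scaleN1r.
by apply: glspanD; apply: glspan_mul.
Qed.

Definition glsub P (trP : transitive P) : lieSub (glinf K) :=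
  LieSub (glspan_submod P) (glspan_bracket trP).

Definition relS S : rel int := fun m n => (m \in S) && (n \in S).
Definition relSplus S : rel int := fun m n => n \notin S.
Definition relPar S : rel int := fun m n => relSplus S m n || relS S m n.
Definition relDiag : rel int := fun m n => m == n.

Fact relS_trans S : transitive (relS S).
Proof. by move=> n m p /andP[mS _] /andP[_ pS]; apply/andP. Qed.
Fact relPar_trans S : transitive (relPar S).
Proof. by move=> n m p; rewrite /relPar /relSplus /relS; do 3 case: (_ \in S). Qed.
Fact relDiag_trans : transitive relDiag.
Proof. by move=> n m p /eqP -> . Qed.

Definition glS S := glsub (@relS_trans S).

(* gl_oo^(S,+) + gl_S: both summands are spanned by matrix units *)
Definition glPar S := glsub (@relPar_trans S).

Definition glH := glsub relDiag_trans.

(* The projection of gl_oo^(S,+) + gl_S onto gl_S along gl_oo^(S,+): it kills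
   the matrix units gE m n with n \notin S. *)
Definition corner_fun S : glinf K -> glinf K :=
  malg_ext (fun p => if relS S p.1 p.2 then gE p.1 p.2 else 0).
HB.instance Definition _ S := GRing.Linear.on (corner_fun S).

Lemma corner_funD S a x y :
  corner_fun S (a *: x + y) = a *: corner_fun S x + corner_fun S y.
Proof. exact: malg_ext_is_linear. Qed.

Lemma corner_fun0 S : corner_fun S 0 = 0.
Proof. exact: linear0. Qed.

Lemma corner_funE S m n : corner_fun S (gE m n) = if relS S m n then gE m n else 0.
Proof. by rewrite /corner_fun gE.unlock malg_extU. Qed.

Lemma corner_fun_in S x : corner_fun S x \in glspan (relS S).
Proof.
elim/(@gl_ind K): x => [|a u v Hu Hv|m n].
- by rewrite corner_fun0; exact: glspan0.
- by rewrite corner_funD; exact: glspanD.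
by rewrite corner_funE; case: ifP => [/glspan_E//|_]; exact: glspan0.
Qed.

Definition corner S (x : glPar S) : glS S := @LieSubEl K (glinf K) (glS S) _ (corner_fun_in S (lsval x)).

Lemma corner_is_linear S : linear (@corner S).
Proof. by move=> a x y; apply/val_inj; exact: corner_funD. Qed.

Lemma corner_mul S x y : x \in glspan (relPar S) -> y \in glspan (relPar S) ->
  corner_fun S (glmul x y) = glmul (corner_fun S x) (corner_fun S y).
Proof.
pose c := corner_fun S.
move=> Px Py; elim/(@glspan_ind (relPar S)): Px => [|a u v Pu Pv|m n Pmn].
- by rewrite (glmul0x y) corner_fun0 (glmul0x (c y)).
- by rewrite (glmulDl a u v y) !corner_funD (glmulDl a (c u)) Pu Pv.
elim/(@glspan_ind (relPar S)): Py => [|a u v Pu Pv|r s Prs].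
- by rewrite (glmulx0 (gE m n)) corner_fun0 (glmulx0 (c _)).
- by rewrite (glmulDr a (gE m n) u v) !corner_funD (glmulDr a (c _) (c u)) Pu Pv.
rewrite (glmulE m n r s) (corner_funE S m n) (corner_funE S r s).
move: Pmn Prs; rewrite /relPar /relSplus /relS.
have [<-|nr] := eqVneq n r; last first.
  move=> _ _; rewrite corner_fun0; case: ifP => _; last by rewrite (glmul0x (if _ then _ else _)).
  case: ifP => _; last by rewrite (glmulx0 (gE m n)).
  by rewrite (glmulE m n r s) (negPf nr).
rewrite (corner_funE S m s) /relS.
case: (m \in S); case: (n \in S); case: (s \in S) => //= _ _;
  by rewrite ?(glmul0x 0) ?(glmulx0 (gE m n)) ?(glmul0x (gE n s)) // (glmulE m n n s) eqxx.
Qed.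

Lemma corner_bracket S (x y : glPar S) :
  corner (bracket x y) = bracket (corner x) (corner y).
Proof.
apply/val_inj; rewrite /= /bracket/= /glbracket.
rewrite addrC -scaleN1r corner_funD scaleN1r addrC.
by rewrite !corner_mul //; apply: lsvalP.
Qed.

Section Inflate.
Context (S : {pred int}) (U : lieModType (glS S)).

(* U, as a module over gl_oo^(S,+) + gl_S, with trivial action of gl_oo^(S,+) *)
Definition inflate : Type := U.
HB.instance Definition _ := GRing.Lmodule.on inflate.

Definition inflate_act (x : glPar S) (u : inflate) : inflate :=
  act (corner x) (u : U).

Fact inflate_actDl a (x y : glPar S) u : inflate_act (a *: x + y) u
  = a *: inflate_act x u + inflate_act y u.
Proof. by rewrite /inflate_act corner_is_linear actDl. Qed.
Fact inflate_actDr a (x : glPar S) u v : inflate_act x (a *: u + v)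
  = a *: inflate_act x u + inflate_act x v.
Proof. exact: actDr. Qed.
Fact inflate_act_bracket (x y : glPar S) u : inflate_act (bracket x y) u
  = inflate_act x (inflate_act y u) - inflate_act y (inflate_act x u).
Proof. by rewrite /inflate_act corner_bracket act_bracket. Qed.

HB.instance Definition _ := Lmodule_isLieModule.Build K (glPar S) inflate
  inflate_actDl inflate_actDr inflate_act_bracket.
End Inflate.

Definition hE (i : int) : glH :=
  @LieSubEl K (glinf K) glH _ (glspan_E (P := relDiag) (m := i) (n := i) (eqxx i)).

End GlSub.

Section AlgBilinear.
Context {K : fieldType} {A : algType K}.
Lemma alg_mulDl c (u v w : A) : (c *: u + v) * w = c *: (u * w) + v * w.
Proof. by rewrite mulrDl scalerAl. Qed.
Lemma alg_mulDr c (u v w : A) : w * (c *: u + v) = c *: (w * u) + w * v.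
Proof. by rewrite mulrDr scalerAr. Qed.
End AlgBilinear.

Section FreeAlgebra.
Context {K : fieldType} {X : choiceType}.
Local Notation F := {malg K[{fmonom X}]}.

Lemma fmonom_ind (P : {fmonom X} -> Prop) : P mone ->
  (forall x w, P w -> P (mmul (fmu x) w)) -> forall w, P w.
Proof.
move=> P1 PM [w]; elim: w => [|x w IH].
  by suff -> : FMonom [::] = mone :> {fmonom X} by []; apply/val_inj; rewrite /= fm1.
suff -> : FMonom (x :: w) = mmul (fmu x) (FMonom w) :> {fmonom X} by apply: PM.
by apply/val_inj; rewrite /= fmM fmU.
Qed.

Lemma malgUM (v w : {fmonom X}) : << v >> * << w >> = << mmul v w >> :> F.
Proof. by rewrite malgM_def fgmulUU mulr1. Qed.

Lemma malg_mulrZ c (a b : F) : a * (c *: b) = c *: (a * b).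
Proof.
suff comm : a * c%:MP = c%:MP * a by rewrite -(mul_malgC c b) mulrA comm -mulrA mul_malgC.
elim/(@malg_ind K {fmonom X}): a => [|d u v Hu Hv|w]; first by rewrite mul0r mulr0.
  rewrite mulrDl mulrDr -scalerAl Hu Hv; congr (_ + _).
  by rewrite !mul_malgC !scalerA mulrC.
by rewrite mul_malgC malgM_def fgmulUU mul1r mulm1 malgUZ.
Qed.

Lemma malg1 : 1 = << mone >> :> F. Proof. by []. Qed.
End FreeAlgebra.

(* The universal enveloping algebra: the tensor algebra of L is the quotient of
   the free algebra env_free on the set L by the relations env_rel_lin. *)
Definition env_free (K : fieldType) (L : lieAlgType K) := {malg K[{fmonom L}]}.
HB.instance Definition _ (K : fieldType) (L : lieAlgType K) :=
  GRing.Lalgebra.on (env_free L).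
HB.instance Definition _ (K : fieldType) (L : lieAlgType K) :=
  GRing.Lalgebra_isAlgebra.Build K (env_free L)
    (fun c a b => esym (malg_mulrZ c a b)).

HB.lock Definition env_gen (K : fieldType) (L : lieAlgType K) (x : L) :
  env_free L := << fmu x >>.

Section Envelope.
Context {K : fieldType} (L : lieAlgType K).
Local Notation env_free := (env_free L).

Lemma env_free_ind (P : env_free -> Prop) : P 0 ->
  (forall a (u v : env_free), P u -> P v -> P (a *: u + v)) ->
  (forall w, P << w >>) -> forall u, P u.
Proof. exact: malg_ind. Qed.

Inductive env_rel : env_free -> Prop :=
| env_rel_lin a x y :
    env_rel (env_gen (a *: x + y) - (a *: env_gen x + env_gen y))
| env_rel_bracket x y :
    env_rel (env_gen x * env_gen y - env_gen y * env_gen x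
             - env_gen (bracket x y)).

Definition env_ideal_set (a : env_free) : Prop :=
  forall J : subspace env_free, (forall b, env_rel b -> J b) ->
  (forall b c, J c -> J (b * c)) -> (forall b c, J c -> J (c * b)) -> J a.

Fact env_ideal0 : env_ideal_set 0.
Proof. by move=> J _ _ _; apply: subspace0. Qed.
Fact env_idealP c a b :
  env_ideal_set a -> env_ideal_set b -> env_ideal_set (c *: a + b).
Proof.
by move=> Ja Jb J JR Jl Jr; apply: subspaceP; [apply: Ja | apply: Jb].
Qed.

Definition env_ideal_sub : subspace env_free := Subspace env_ideal0 env_idealP.

Lemma env_ideal_rel a : env_rel a -> env_ideal_sub a.
Proof. by move=> Ra J JR _ _; apply: JR. Qed.

Fact env_idealMl a b : env_ideal_sub b -> env_ideal_sub (a * b).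
Proof. by move=> Jb J JR Jl Jr; apply: (Jl a b (Jb J JR Jl Jr)). Qed.
Fact env_idealMr a b : env_ideal_sub b -> env_ideal_sub (b * a).
Proof. by move=> Jb J JR Jl Jr; apply: (Jr a b (Jb J JR Jl Jr)). Qed.

(* the augmentation is a morphism vanishing on env_rel *)
Fact aug_sub0 : (0 : env_free)@_mone = 0. Proof. exact: mcoeff0. Qed.
Fact aug_subP a (u v : env_free) :
  u@_mone = 0 -> v@_mone = 0 -> (a *: u + v)@_mone = 0.
Proof. by move=> u0 v0; rewrite mcoeffD mcoeffZ u0 v0 mulr0 addr0. Qed.

Fact env_ideal_proper : ~ env_ideal_sub 1.
Proof.
have augM := (@mcoeff1g_is_multiplicative {fmonom L} K).1.
have gen0 x : (env_gen x)@_mone = 0.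
  by rewrite env_gen.unlock mcoeffU -fdeg_eq0 fdegU.
move/(_ (Subspace aug_sub0 aug_subP)) => /= aug1.
suff : (1 : env_free)@_mone = 0 by rewrite mcoeffUU => /eqP; rewrite oner_eq0.
apply: aug1 => [b [a x y | x y] | b c c0 | b c c0].
- by rewrite mcoeffB mcoeffD mcoeffZ !gen0 mulr0 addr0 subr0.
- have B0 (u v w : env_free) : u@_mone = 0 -> v@_mone = 0 -> w@_mone = 0 ->
    (u - v - w)@_mone = 0 by rewrite !mcoeffB => -> -> ->; rewrite !subr0.
  rewrite /=; apply: B0 => /=; last exact: gen0.
    by apply: etrans (augM (env_gen x) (env_gen y)) _; rewrite !gen0 mul0r.
  by apply: etrans (augM (env_gen y) (env_gen x)) _; rewrite !gen0 mul0r.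
- by rewrite augM c0 mulr0.
- by rewrite augM c0 mul0r.
Qed.

Definition env_ideal : ideal env_free :=
  Ideal env_idealMl env_idealMr env_ideal_proper.

Definition env := aquot env_ideal.
HB.instance Definition _ := GRing.Algebra.on env.

Definition env_pi : env_free -> env := aqpi env_ideal.
HB.instance Definition _ := GRing.Linear.on env_pi.

Lemma env_piM a b : env_pi (a * b) = env_pi a * env_pi b.
Proof. exact: aqpiM. Qed.

Lemma env_pi_ind (P : env -> Prop) : (forall a, P (env_pi a)) -> forall u, P u.
Proof. exact: aqpi_ind. Qed.

(* the canonical map L -> U(L) *)
Definition env_in (x : L) : env := env_pi (env_gen x).

Lemma env_in_is_linear : linear env_in.
Proof.
move=> a x y; rewrite /env_in -linearP; apply: qpi_eq.
exact/env_ideal_rel/env_rel_lin.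
Qed.
HB.instance Definition _ := GRing.isLinear.Build K L env *:%R env_in env_in_is_linear.

Lemma env_in_bracket x y :
  env_in (bracket x y) = env_in x * env_in y - env_in y * env_in x.
Proof.
rewrite /env_in -!env_piM -linearB; apply/esym/qpi_eq.
exact/env_ideal_rel/env_rel_bracket.
Qed.

Lemma env_ind (P : env -> Prop) : P 1 ->
  (forall a u v, P u -> P v -> P (a *: u + v)) ->
  (forall x u, P u -> P (env_in x * u)) -> forall u, P u.
Proof.
move=> P1 PD PM; elim/env_pi_ind=> u.
elim/env_free_ind: u => [|a u v Pu Pv|w].
- have := PD (-1) 1 1 P1 P1.
  by rewrite scaleN1r addNr -(linear0 env_pi).
- by rewrite [X in P X](linearP env_pi); apply: PD.
elim/(@fmonom_ind L): w => [|x w Pw]; first exact: P1.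
by rewrite -malgUM [X in P X]env_piM; have := PM x _ Pw; rewrite /env_in env_gen.unlock.
Qed.

(* the algebra morphism U(L) -> A extending f : L -> A *)
Section Lift.
Context {A : algType K} (f : L -> A).

Definition env_free_lift : env_free -> A :=
  malg_ext (fun w : {fmonom L} => \prod_(x <- w) f x).
HB.instance Definition _ := GRing.Linear.on env_free_lift.

Lemma env_free_liftD c u v :
  env_free_lift (c *: u + v) = c *: env_free_lift u + env_free_lift v.
Proof. exact: malg_ext_is_linear. Qed.

Lemma env_free_liftB u v : env_free_lift (u - v) = env_free_lift u - env_free_lift v.
Proof. exact: linearB. Qed.

Definition env_lift (u : env) : A := quot_lift env_free_lift u.

Lemma env_free_lift_gen x : env_free_lift (env_gen x) = f x.
Proof. by rewrite env_gen.unlock /env_free_lift malg_extU fmU big_seq1. Qed.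

Lemma env_free_lift1 : env_free_lift 1 = 1.
Proof. by rewrite /env_free_lift malg_extU fm1 big_nil. Qed.

Lemma env_free_liftM a b :
  env_free_lift (a * b) = env_free_lift a * env_free_lift b.
Proof.
elim/env_free_ind: a => [|c u v Hu Hv|w].
- by rewrite mul0r linear0 mul0r.
- rewrite (alg_mulDl c u v b) (env_free_liftD c (u * b)) (env_free_liftD c u v).
  by rewrite (alg_mulDl c (env_free_lift u)); congr (_ *: _ + _).
elim/env_free_ind: b => [|c u v Hu Hv|w'].
- by rewrite mulr0 linear0 mulr0.
- rewrite (alg_mulDr c u v) (env_free_liftD c (_ * u)) (env_free_liftD c u v).
  by rewrite (alg_mulDr c (env_free_lift u)); congr (_ *: _ + _).
by rewrite [X in env_free_lift X]malgUM /env_free_lift !malg_extU fmM big_cat.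
Qed.

Hypothesis f_lin : linear f.
Hypothesis f_bracket : forall x y, f (bracket x y) = f x * f y - f y * f x.

Lemma env_liftE a : env_lift (env_pi a) = env_free_lift a.
Proof.
apply: quot_liftE => v /(_ (ker env_free_lift)); apply.
- move=> b [c x y | x y] /=.
    by rewrite env_free_liftB env_free_liftD !env_free_lift_gen f_lin subrr.
  rewrite env_free_liftB env_free_lift_gen f_bracket env_free_liftB.
  by apply/eqP; rewrite subr_eq0; apply/eqP; congr (_ - _);
    rewrite env_free_liftM !env_free_lift_gen.
- by move=> b c /= c0; rewrite env_free_liftM c0 mulr0.
- by move=> b c /= c0; rewrite env_free_liftM c0 mul0r.
Qed.

Lemma env_lift_in x : env_lift (env_in x) = f x.
Proof. by rewrite env_liftE env_free_lift_gen. Qed.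

Lemma env_lift1 : env_lift 1 = 1.
Proof. by rewrite [LHS]env_liftE env_free_lift1. Qed.

Lemma env_liftM u v : env_lift (u * v) = env_lift u * env_lift v.
Proof.
elim/env_pi_ind: u => u; elim/env_pi_ind: v => v.
by rewrite -[X in env_lift X]env_piM !env_liftE env_free_liftM.
Qed.

Lemma env_lift_is_linear : linear env_lift.
Proof.
move=> a; elim/env_pi_ind=> u; elim/env_pi_ind=> v.
by rewrite -[X in env_lift X]linearP !env_liftE env_free_liftD.
Qed.
End Lift.

(* the action of U(L) on an L-module *)
Section EnvAct.
Context (V : lieModType L).

Definition env_free_act (v : V) : env_free -> V :=
  malg_ext (fun w : {fmonom L} => foldr (fun x => act x) v w).
HB.instance Definition _ v := GRing.Linear.on (env_free_act v).

Lemma env_free_actDl c a b v :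
  env_free_act v (c *: a + b) = c *: env_free_act v a + env_free_act v b.
Proof. exact: malg_ext_is_linear. Qed.

Lemma env_free_actB a b v :
  env_free_act v (a - b) = env_free_act v a - env_free_act v b.
Proof. exact: linearB. Qed.

Definition env_act (u : env) (v : V) : V := quot_lift (env_free_act v) u.

Lemma env_free_actDr a b u v :
  env_free_act (a *: u + v) b = a *: env_free_act u b + env_free_act v b.
Proof.
rewrite -malg_extZ -malg_extD; apply: eq_malg_ext => -[w].
by elim: w => //= x w ->; rewrite actDr.
Qed.

Lemma env_free_act_gen x v : env_free_act v (env_gen x) = act x v.
Proof. by rewrite env_gen.unlock /env_free_act malg_extU fmU. Qed.

Lemma env_free_act1 v : env_free_act v 1 = v.
Proof. by rewrite /env_free_act malg_extU fm1. Qed.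

Lemma env_free_actM a b v :
  env_free_act v (a * b) = env_free_act (env_free_act v b) a.
Proof.
elim/env_free_ind: a => [|c u u' Hu Hu'|w].
- by rewrite mul0r !linear0.
- rewrite (alg_mulDl c u u' b) (env_free_actDl c (u * b)).
  by rewrite (env_free_actDl c u); congr (_ *: _ + _).
elim/env_free_ind: b => [|c u u' Hu Hu'|w'].
- rewrite mulr0 !linear0; have := env_free_actDr (-1) << w >> 0 0.
  by rewrite scaler0 addr0 scaleN1r addNr.
- rewrite (alg_mulDr c u u') (env_free_actDl c (_ * u)) (env_free_actDl c u).
  by rewrite env_free_actDr; congr (_ *: _ + _).
by rewrite [X in env_free_act _ X]malgUM /env_free_act !malg_extU fmM foldr_cat.
Qed.

Lemma env_actE a v : env_act (env_pi a) v = env_free_act v a.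
Proof.
suff h c : env_ideal c -> forall v, env_free_act v c = 0.
  by apply: quot_liftE => c /h; apply.
pose J0 c := forall v, env_free_act v c = 0.
have J00 : J0 0 by move=> w; rewrite linear0.
have J0P b x y : J0 x -> J0 y -> J0 (b *: x + y).
  by move=> Jx Jy w; rewrite env_free_actDl Jx Jy scaler0 addr0.
have act0 x : env_free_act 0 x = 0.
  have := env_free_actDr (-1) x 0 0.
  by rewrite scaler0 addr0 scaleN1r addNr.
move=> /(_ (Subspace J00 J0P)); apply.
- move=> x [b y z | y z] w /=.
    by rewrite env_free_actB env_free_actDl !env_free_act_gen actDl subrr.
  rewrite env_free_actB env_free_act_gen act_bracket env_free_actB.
  by apply/eqP; rewrite subr_eq0; apply/eqP; congr (_ - _);
    rewrite env_free_actM !env_free_act_gen.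
- by move=> x y Jy w; rewrite env_free_actM Jy act0.
- by move=> x y Jy w; rewrite env_free_actM Jy.
Qed.

Lemma env_act_in x v : env_act (env_in x) v = act x v.
Proof. by rewrite env_actE env_free_act_gen. Qed.

Lemma env_act1 v : env_act 1 v = v.
Proof. by rewrite [LHS]env_actE env_free_act1. Qed.

Lemma env_actM a b v : env_act (a * b) v = env_act a (env_act b v).
Proof.
elim/env_pi_ind: a => a; elim/env_pi_ind: b => b.
by rewrite -[X in env_act X]env_piM !env_actE env_free_actM.
Qed.

Lemma env_actDl c a b v : env_act (c *: a + b) v = c *: env_act a v + env_act b v.
Proof.
elim/env_pi_ind: a => a; elim/env_pi_ind: b => b.
by rewrite -[X in env_act X]linearP !env_actE env_free_actDl.
Qed.

Lemma env_actDr c a u v : env_act a (c *: u + v) = c *: env_act a u + env_act a v.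
Proof. by elim/env_pi_ind: a => a; rewrite !env_actE env_free_actDr. Qed.
End EnvAct.
End Envelope.

(* U(P) -> U(L) for a Lie subalgebra P of L *)
Definition env_incl (K : fieldType) (L : lieAlgType K) (P : lieSub L) :
  env P -> env L := env_lift (fun x : P => env_in (lsval x)).

Section EnvIncl.
Context {K : fieldType} {L : lieAlgType K} (P : lieSub L).
Let f_lin : linear (fun x : P => env_in (lsval x)).
Proof. by move=> a x y; rewrite -linearP. Qed.
Let f_br (x y : P) : env_in (lsval (bracket x y)) =
  env_in (lsval x) * env_in (lsval y) - env_in (lsval y) * env_in (lsval x).
Proof. exact: env_in_bracket. Qed.

Lemma env_incl_in (x : P) : env_incl (env_in x) = env_in (lsval x).
Proof. exact: env_lift_in f_lin f_br x. Qed.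
Lemma env_incl1 : env_incl (1 : env P) = 1.
Proof. exact: env_lift1 f_lin f_br. Qed.
Lemma env_inclM (a b : env P) : env_incl (a * b) = env_incl a * env_incl b.
Proof. exact: env_liftM f_lin f_br a b. Qed.
Lemma env_incl_is_linear : linear (@env_incl K L P).
Proof. exact: env_lift_is_linear f_lin f_br. Qed.
End EnvIncl.

(* The tensor product over A of a right A-module M and a left A-module N, as the
   quotient of the free vector space on M * N by bilinearity and by
   m a (x) n = m (x) a n. *)
HB.lock Definition tfree_pure (K : fieldType) (M N : lmodType K) (m : M) (n : N) :
  {malg K[(M * N)%type]} := << (m, n) >>.

Section Tensor.
Context {K : fieldType} {M N : lmodType K} {A : Type}.
Context (ract : M -> A -> M) (lact : A -> N -> N).

Inductive tens_rel : {malg K[(M * N)%type]} -> Prop :=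
| tens_rel_l a m m' n : tens_rel
    (tfree_pure (a *: m + m') n - (a *: tfree_pure m n + tfree_pure m' n))
| tens_rel_r a m n n' : tens_rel
    (tfree_pure m (a *: n + n') - (a *: tfree_pure m n + tfree_pure m n'))
| tens_rel_bal m a n : tens_rel
    (tfree_pure (ract m a) n - tfree_pure m (lact a n)).

Definition tens := quot (span tens_rel).
HB.instance Definition _ := GRing.Lmodule.on tens.

Definition tpure (m : M) (n : N) : tens := qpi (span tens_rel) (tfree_pure m n).

Lemma tpureDl a m m' n : tpure (a *: m + m') n = a *: tpure m n + tpure m' n.
Proof. by rewrite -[RHS]linearP; apply/qpi_eq/sub_span/tens_rel_l. Qed.

Lemma tpureDr a m n n' : tpure m (a *: n + n') = a *: tpure m n + tpure m n'.
Proof. by rewrite -[RHS]linearP; apply/qpi_eq/sub_span/tens_rel_r. Qed.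

Lemma tpure_bal m a n : tpure (ract m a) n = tpure m (lact a n).
Proof. exact/qpi_eq/sub_span/tens_rel_bal. Qed.

Lemma tens_pi_ind (P : tens -> Prop) :
  (forall v, P (qpi (span tens_rel) v)) -> forall u, P u.
Proof. exact: qpi_ind. Qed.

Lemma tens_ind (P : tens -> Prop) : P 0 ->
  (forall a u v, P u -> P v -> P (a *: u + v)) ->
  (forall m n, P (tpure m n)) -> forall u, P u.
Proof.
move=> P0 PD PP; elim/tens_pi_ind=> u.
elim/(@malg_ind K (M * N)%type): u => [|a u v Pu Pv|[m n]].
- by rewrite linear0.
- by rewrite linearP; apply: PD.
by have := PP m n; rewrite /tpure tfree_pure.unlock.
Qed.

Lemma tens_eq (W : lmodType K) (f g : {linear tens -> W}) :
  (forall m n, f (tpure m n) = g (tpure m n)) -> f =1 g.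
Proof.
move=> fg; elim/tens_ind => [|a u v Hu Hv|//]; first by rewrite !linear0.
by rewrite !linearP Hu Hv.
Qed.

Section Lift.
Context {W : lmodType K} (b : M -> N -> W).

Definition tens_free_lift : {malg K[(M * N)%type]} -> W :=
  malg_ext (fun p => b p.1 p.2).
HB.instance Definition _ := GRing.Linear.on tens_free_lift.

Definition tens_lift (u : tens) : W := quot_lift tens_free_lift u.

Lemma tens_free_lift_pure m n : tens_free_lift (tfree_pure m n) = b m n.
Proof. by rewrite tfree_pure.unlock /tens_free_lift malg_extU. Qed.

Hypothesis bDl : forall a m m' n, b (a *: m + m') n = a *: b m n + b m' n.
Hypothesis bDr : forall a m n n', b m (a *: n + n') = a *: b m n + b m n'.
Hypothesis b_bal : forall m a n, b (ract m a) n = b m (lact a n).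

Lemma tens_liftE v :
  tens_lift (qpi (span tens_rel) v) = tens_free_lift v.
Proof.
have fB u w : tens_free_lift (u - w) = tens_free_lift u - tens_free_lift w.
  exact: linearB.
have fD a u w :
  tens_free_lift (a *: u + w) = a *: tens_free_lift u + tens_free_lift w.
  exact: malg_ext_is_linear.
apply: quot_liftE => {}v /(_ (ker tens_free_lift)); apply=> x.
case=> [a m m' n|a m n n'|m a n] /=.
- by rewrite fB fD !tens_free_lift_pure bDl subrr.
- by rewrite fB fD !tens_free_lift_pure bDr subrr.
- by rewrite fB !tens_free_lift_pure b_bal subrr.
Qed.

Lemma tens_lift_pure m n : tens_lift (tpure m n) = b m n.
Proof. by rewrite tens_liftE tens_free_lift_pure. Qed.

Lemma tens_lift_is_linear : linear tens_lift.
Proof.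
move=> a; elim/tens_pi_ind=> u; elim/tens_pi_ind=> v.
by rewrite -[X in tens_lift X]linearP !tens_liftE; apply: malg_ext_is_linear.
Qed.
End Lift.
End Tensor.

(* V (x) W over the base field, with x (v (x) w) = x v (x) w + v (x) x w *)
Section TensorModule.
Context {K : fieldType} {L : lieAlgType K} (V W : lieModType L).

Definition tensor : Type :=
  tens (fun (v : V) (c : K) => c *: v) (fun (c : K) (w : W) => c *: w).
HB.instance Definition _ := GRing.Lmodule.on tensor.

Definition tensor_pure (v : V) (w : W) : tensor := tpure _ _ v w.

Lemma tensor_pureDl a v v' w :
  tensor_pure (a *: v + v') w = a *: tensor_pure v w + tensor_pure v' w.
Proof. exact: tpureDl. Qed.
Lemma tensor_pureDr a v w w' :
  tensor_pure v (a *: w + w') = a *: tensor_pure v w + tensor_pure v w'.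
Proof. exact: tpureDr. Qed.
Lemma tensor_pureZ a v w : tensor_pure (a *: v) w = tensor_pure v (a *: w).
Proof. exact: (tpure_bal (fun (v : V) (c : K) => c *: v)). Qed.

Lemma tensor_ind (P : tensor -> Prop) : P 0 ->
  (forall a u v, P u -> P v -> P (a *: u + v)) ->
  (forall v w, P (tensor_pure v w)) -> forall u, P u.
Proof. exact: tens_ind. Qed.

Definition tensor_act (x : L) : tensor -> tensor :=
  tens_lift (fun v w => tensor_pure (act x v) w + tensor_pure v (act x w)).

Fact tensor_act_bilin x :
  [/\ forall a v v' w, tensor_pure (act x (a *: v + v')) w
        + tensor_pure (a *: v + v') (act x w)
      = a *: (tensor_pure (act x v) w + tensor_pure v (act x w))
        + (tensor_pure (act x v') w + tensor_pure v' (act x w)),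
      forall a v w w', tensor_pure (act x v) (a *: w + w')
        + tensor_pure v (act x (a *: w + w'))
      = a *: (tensor_pure (act x v) w + tensor_pure v (act x w))
        + (tensor_pure (act x v) w' + tensor_pure v (act x w')) &
      forall v (a : K) w, tensor_pure (act x (a *: v)) w
        + tensor_pure (a *: v) (act x w)
      = tensor_pure (act x v) (a *: w) + tensor_pure v (act x (a *: w))].
Proof.
split=> [a v v' w|a v w w'|v a w].
- by rewrite actDr !tensor_pureDl scalerDr addrACA.
- by rewrite actDr !tensor_pureDr scalerDr addrACA.
- by rewrite !linearZ /= !tensor_pureZ.
Qed.

Lemma tensor_act_pure x v w : tensor_act x (tensor_pure v w)
  = tensor_pure (act x v) w + tensor_pure v (act x w).
Proof. by have [h1 h2 h3] := tensor_act_bilin x; apply: tens_lift_pure. Qed.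

Fact tensor_actDr a x u v :
  tensor_act x (a *: u + v) = a *: tensor_act x u + tensor_act x v.
Proof. by have [h1 h2 h3] := tensor_act_bilin x; apply: tens_lift_is_linear. Qed.

Let tensor_act0 x : tensor_act x 0 = 0.
Proof.
by have := tensor_actDr (-1) x 0 0; rewrite scaler0 addr0 scaleN1r addNr.
Qed.

Fact tensor_actDl a x y u :
  tensor_act (a *: x + y) u = a *: tensor_act x u + tensor_act y u.
Proof.
elim/tensor_ind: u => [|b u v Hu Hv|v w].
- by rewrite !tensor_act0 scaler0 addr0.
- rewrite !tensor_actDr Hu Hv !scalerDr !scalerA [b * a]mulrC.
  exact: addrACA.
- by rewrite !tensor_act_pure !actDl tensor_pureDl tensor_pureDr scalerDr addrACA.
Qed.

Fact tensor_act_bracket x y u : tensor_act (bracket x y) u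
  = tensor_act x (tensor_act y u) - tensor_act y (tensor_act x u).
Proof.
elim/tensor_ind: u => [|b u v Hu Hv|v w].
- by rewrite !tensor_act0 subrr.
- by rewrite !tensor_actDr Hu Hv scalerBr addrACA opprD.
have actD z u1 u2 : tensor_act z (u1 + u2) = tensor_act z u1 + tensor_act z u2.
  by have := tensor_actDr 1 z u1 u2; rewrite (scale1r u1) (scale1r (tensor_act z u1)).
have pBl v1 v2 w1 : tensor_pure (v1 - v2) w1 = tensor_pure v1 w1 - tensor_pure v2 w1.
  by rewrite addrC -scaleN1r tensor_pureDl scaleN1r addrC.
have pBr v1 w1 w2 : tensor_pure v1 (w1 - w2) = tensor_pure v1 w1 - tensor_pure v1 w2.
  by rewrite addrC -scaleN1r tensor_pureDr scaleN1r addrC.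
rewrite !tensor_act_pure !actD !tensor_act_pure !act_bracket pBl pBr.
have reorder (p1 p2 p3 p4 c1 c2 : tensor) : p1 - p2 + (p3 - p4)
    = p1 + c1 + (c2 + p3) - (p2 + c2 + (c1 + p4)).
  rewrite [c2 + p3]addrC [p1 + c1 + _]addrACA [c1 + p4]addrC.
  rewrite [p2 + c2 + _]addrACA [c2 + c1]addrC opprD [RHS]addrACA subrr addr0.
  by rewrite opprD [LHS]addrACA.
exact: reorder.
Qed.

HB.instance Definition _ := Lmodule_isLieModule.Build K L tensor
  tensor_actDl (fun a x u v => tensor_actDr a x u v) tensor_act_bracket.
End TensorModule.

(* U(L) (x)_{U(P)} U for a Lie subalgebra P of L and a P-module U *)
Section Induced.
Context {K : fieldType} {L : lieAlgType K} (P : lieSub L) (U : lieModType P).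

Definition induced : Type :=
  tens (fun (u : env L) (a : env P) => u * env_incl a)
       (fun (a : env P) (v : U) => env_act a v).
HB.instance Definition _ := GRing.Lmodule.on induced.

Definition induced_pure (u : env L) (v : U) : induced := tpure _ _ u v.

Lemma induced_pureDl a u u' v :
  induced_pure (a *: u + u') v = a *: induced_pure u v + induced_pure u' v.
Proof. exact: tpureDl. Qed.
Lemma induced_pureDr a u v v' :
  induced_pure u (a *: v + v') = a *: induced_pure u v + induced_pure u v'.
Proof. exact: tpureDr. Qed.
Lemma induced_pure_bal u a v :
  induced_pure (u * env_incl a) v = induced_pure u (env_act a v).
Proof. exact: (tpure_bal (fun (u : env L) (a : env P) => u * env_incl a)). Qed.

Lemma induced_ind (Q : induced -> Prop) : Q 0 ->
  (forall a u v, Q u -> Q v -> Q (a *: u + v)) ->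
  (forall u v, Q (induced_pure u v)) -> forall u, Q u.
Proof. exact: tens_ind. Qed.

Definition induced_act (x : L) : induced -> induced :=
  tens_lift (fun u v => induced_pure (env_in x * u) v).

Fact induced_act_bilin x :
  [/\ forall a u u' v, induced_pure (env_in x * (a *: u + u')) v
      = a *: induced_pure (env_in x * u) v + induced_pure (env_in x * u') v,
      forall a u v v', induced_pure (env_in x * u) (a *: v + v')
      = a *: induced_pure (env_in x * u) v + induced_pure (env_in x * u) v' &
      forall u a v, induced_pure (env_in x * (u * env_incl a)) v
      = induced_pure (env_in x * u) (env_act a v)].
Proof.
split=> [a u u' v|a u v v'|u a v].
- by rewrite (alg_mulDr a u u') induced_pureDl.
- by rewrite induced_pureDr.
- exact: etrans (congr1 (induced_pure^~ v) (mulrA _ u _)) (induced_pure_bal _ a v).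
Qed.

Lemma induced_act_pure x u v :
  induced_act x (induced_pure u v) = induced_pure (env_in x * u) v.
Proof. by have [h1 h2 h3] := induced_act_bilin x; apply: tens_lift_pure. Qed.

Fact induced_actDr a x u v :
  induced_act x (a *: u + v) = a *: induced_act x u + induced_act x v.
Proof. by have [h1 h2 h3] := induced_act_bilin x; apply: tens_lift_is_linear. Qed.

Let induced_act0 x : induced_act x 0 = 0.
Proof.
by have := induced_actDr (-1) x 0 0; rewrite scaler0 addr0 scaleN1r addNr.
Qed.

Fact induced_actDl a x y u :
  induced_act (a *: x + y) u = a *: induced_act x u + induced_act y u.
Proof.
elim/induced_ind: u => [|b u v Hu Hv|u v].
- by rewrite !induced_act0 scaler0 addr0.
- rewrite !induced_actDr Hu Hv !scalerDr !scalerA [b * a]mulrC.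
  exact: addrACA.
- rewrite !induced_act_pure env_in_is_linear.
  by rewrite (alg_mulDl a (env_in x)) induced_pureDl.
Qed.

Fact induced_act_bracket x y u : induced_act (bracket x y) u
  = induced_act x (induced_act y u) - induced_act y (induced_act x u).
Proof.
elim/induced_ind: u => [|b u v Hu Hv|u v].
- by rewrite !induced_act0 subrr.
- by rewrite !induced_actDr Hu Hv scalerBr addrACA opprD.
have pBl v1 v2 w : induced_pure (v1 - v2) w = induced_pure v1 w - induced_pure v2 w.
  by rewrite addrC -scaleN1r induced_pureDl scaleN1r addrC.
rewrite !induced_act_pure env_in_bracket (mulrBl u) pBl.
by rewrite (mulrA (env_in x) (env_in y)) (mulrA (env_in y) (env_in x)).
Qed.

HB.instance Definition _ := Lmodule_isLieModule.Build K L induced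
  induced_actDl (fun a x u v => induced_actDr a x u v) induced_act_bracket.
End Induced.

Section DirectSum.
Context {K : fieldType} {L : lieAlgType K} {I : Type} (V : I -> lieModType L).

Record dsum : Type := Dsum {
  dsum_fun :> forall i, V i;
  dsum_fin : finite_set (fun i => dsum_fun i <> 0) }.

HB.instance Definition _ := gen_eqMixin dsum.
HB.instance Definition _ := gen_choiceMixin dsum.

Lemma dsumP (u v : dsum) : (forall i, u i = v i) -> u = v.
Proof.
case: u v => [f hf] [g hg] /= fg.
have efg : f = g by apply: functional_extensionality_dep.
by move: hf; rewrite efg => hf; congr Dsum; apply: Prop_irrelevance.
Qed.

Fact dsum0_fin : finite_set (fun i => (0 : V i) <> 0).
Proof. by apply: sub_finite_set (@finite_set0 I) => i /=. Qed.
Definition dsum0 := Dsum dsum0_fin.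

Fact dsumD_fin (u v : dsum) : finite_set (fun i => u i + v i <> 0).
Proof.
have : finite_set ((fun i => u i <> 0) `|` (fun i => v i <> 0))%classic.
  by rewrite finite_setU; split; apply: dsum_fin.
apply: sub_finite_set => i nz; have [ui|] := EM (u i = 0); last by left.
by right=> vi; apply: nz; rewrite ui vi addr0.
Qed.
Definition dsumD u v := Dsum (dsumD_fin u v).

Fact dsumN_fin (u : dsum) : finite_set (fun i => - u i <> 0).
Proof.
by apply: sub_finite_set (dsum_fin u) => i nz ui; apply: nz; rewrite ui oppr0.
Qed.
Definition dsumN u := Dsum (dsumN_fin u).

Fact dsumZ_fin a (u : dsum) : finite_set (fun i => a *: u i <> 0).
Proof.
by apply: sub_finite_set (dsum_fin u) => i nz ui; apply: nz; rewrite ui scaler0.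
Qed.
Definition dsumZ a u := Dsum (dsumZ_fin a u).

Fact dsum_act_fin x (u : dsum) : finite_set (fun i => act x (u i) <> 0).
Proof.
by apply: sub_finite_set (dsum_fin u) => i nz ui; apply: nz; rewrite ui linear0.
Qed.
Definition dsum_act x u := Dsum (dsum_act_fin x u).

Fact dsumA : associative dsumD.
Proof. by move=> u v w; apply: dsumP => i; apply: addrA. Qed.
Fact dsumC : commutative dsumD.
Proof. by move=> u v; apply: dsumP => i; apply: addrC. Qed.
Fact dsum0D : left_id dsum0 dsumD.
Proof. by move=> u; apply: dsumP => i; apply: add0r. Qed.
Fact dsumND : left_inverse dsum0 dsumN dsumD.
Proof. by move=> u; apply: dsumP => i; apply: addNr. Qed.
HB.instance Definition _ := GRing.isZmodule.Build dsum dsumA dsumC dsum0D dsumND.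

Fact dsumZA a b u : dsumZ a (dsumZ b u) = dsumZ (a * b) u.
Proof. by apply: dsumP => i; apply: scalerA. Qed.
Fact dsumZ1 : left_id 1 dsumZ.
Proof. by move=> u; apply: dsumP => i; apply: scale1r. Qed.
Fact dsumZDr : right_distributive dsumZ +%R.
Proof. by move=> a u v; apply: dsumP => i; apply: scalerDr. Qed.
Fact dsumZDl u : {morph dsumZ^~ u : a b / a + b}.
Proof. by move=> a b; apply: dsumP => i; apply: scalerDl. Qed.
HB.instance Definition _ :=
  GRing.Zmodule_isLmodule.Build K dsum dsumZA dsumZ1 dsumZDr dsumZDl.

Fact dsum_actDl a x y u : dsum_act (a *: x + y) u = a *: dsum_act x u + dsum_act y u.
Proof. by apply: dsumP => i; apply: actDl. Qed.
Fact dsum_actDr a x u v : dsum_act x (a *: u + v) = a *: dsum_act x u + dsum_act x v.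
Proof. by apply: dsumP => i; apply: actDr. Qed.
Fact dsum_act_bracket x y u : dsum_act (bracket x y) u
  = dsum_act x (dsum_act y u) - dsum_act y (dsum_act x u).
Proof. by apply: dsumP => i; apply: act_bracket. Qed.
HB.instance Definition _ := Lmodule_isLieModule.Build K L dsum
  dsum_actDl dsum_actDr dsum_act_bracket.
End DirectSum.

Section ModuleNotions.
Context {K : fieldType} {L : lieAlgType K}.
Implicit Types V W : lieModType L.

Definition lie_hom V W (f : V -> W) : Prop :=
  linear f /\ forall x v, f (act x v) = act x (f v).

Definition lie_iso V W : Prop := exists f : V -> W, lie_hom f /\ bijective f.

Definition submodule V (N : subspace V) : Prop := forall x v, N v -> N (act x v).

Definition irreducible_module V : Prop := (exists v : V, v <> 0) /\
  forall N : subspace V, submodule N -> (forall v, N v -> v = 0) \/ (forall v, N v).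

Definition generates V (v : V) : Prop :=
  forall N : subspace V, submodule N -> N v -> forall w, N w.

Definition cyclic_module V : Prop := exists v : V, generates v.

Definition irreducible_quotient V W : Prop :=
  irreducible_module W /\ exists f : V -> W, lie_hom f /\ forall w, exists v, f v = w.
End ModuleNotions.

(* M(S, U) *)
Definition Mod (K : fieldType) (S : {pred int}) (U : lieModType (@glS K S)) :
  lieModType (glinf K) := induced (inflate U).

(* the dual space H^* *)
Definition weight (K : fieldType) := {linear (@glH K) -> K^o}.

Definition weight_at (K : fieldType) (lambda : weight K) (i : int) : K :=
  lambda (hE i).

Section HighestWeight.
Context {K : fieldType}.
Implicit Types (S : {pred int}) (lambda : weight K).

Definition supp lambda : {pred int} := [pred m | weight_at lambda m != 0].

(* The weight of v is the restriction of lambda to H_S, the intersection of H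
   and gl_S; elements of H and of gl_S are compared as elements of gl_oo. *)
Definition is_highest_weight S lambda (V : lieModType (@glS K S)) (v : V) : Prop :=
  [/\ v <> 0,
      forall x : glS S, lsval x \in glspan (fun m n => m < n) -> act x v = 0,
      forall (x : glS S) (h : glH), lsval x = lsval h -> act x v = (lambda h : K) *: v
    & generates v].

(* V is L(lambda_S), which is defined up to isomorphism *)
Definition is_irr_gl S lambda (V : lieModType (@glS K S)) : Prop :=
  irreducible_module V /\ exists v : V, is_highest_weight lambda v.

(* V is L(S, lambda), which is defined up to isomorphism *)
Definition is_L S lambda (V : lieModType (glinf K)) : Prop :=
  exists U : lieModType (@glS K S), is_irr_gl lambda U /\ irreducible_quotient (Mod U) V.
End HighestWeight.

Definition Pplus (K : numFieldType) (S : {pred int}) (lambda : weight K) : Prop :=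
  [/\ forall i, exists k : nat, weight_at lambda i = k%:R,
      forall i, i \notin S -> weight_at lambda i = 0
    & forall i j, i \in S -> j \in S -> i < j -> weight_at lambda j <= weight_at lambda i].

(* {r, r + 1, ..., n} *)
Definition zint (r n : int) : {pred int} := [pred i | r <= i <= n].

(* Main.v *)
From HB Require Import structures.
From mathcomp Require Import all_boot all_order all_algebra perm.
From mathcomp Require Import monalg boolp classical_sets cardinality zify.
From mathcomp Require Import reals complex.
Require Import Defs.
Set Implicit Arguments.
Unset Strict Implicit.
Unset Printing Implicit Defensive.
Import Order.TTheory GRing.Theory Num.Theory.
Local Open Scope ring_scope.

(* For dominant lambda, a graph argument in the product of L(S, lambda) with a
   submodule of a tensor power of the natural module shows that the weights of
   L(S, lambda) are multisets of integers of a fixed size d. In a module V with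
   this property, E_{n,m} E_{m,n} x is a nonzero multiple of x when the weight
   of x contains n but not m. Hence, if |S'| >= d, weight vectors can be moved
   to vectors of weight supported in S': those generate V, and every nonzero
   submodule of V contains one of them. As V is moreover graded by the sum of
   the E_{i,i} with i in S', an isomorphism between the gl_{S'}-modules of
   vectors supported in S' generates, inside of a product, the graph of an
   isomorphism of gl_oo-modules. This applies to L(S, lambda) (x) L(S, mu), of
   degree d + e, and to the direct sum of the L(S', nu).
   For cyclicity, let v be the highest weight vector of L(S, lambda) and move
   that of L(S, mu) to a vector w of weight supported outside of S: then
   v (x) w is a generator. *)

(** * Submodules, graphs and gradings *)

(** [L(S, lambda)] is known only as an irreducible quotient of an induced module, without basis or
    character, so that everything has to be drawn from a highest weight vector. A diagonal operator
    grades the matrix units: a submodule generated in degree c by lowering units has nothing new in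
    degree c, and as the other eigenvalues are c - 1, c - 2, ..., a polynomial in the operator cuts
    out the component of degree c inside any submodule. Homomorphisms are never written down; they
    are submodules of products whose kernels vanish. Having multisets as weights matters because
    multiplicities are not negative: this is why E_{m,n} kills a vector whose weight lacks n. The
    gl_{S'}-module L(lambda_{S'}) (x) L(mu_{S'}) embeds in L(S, lambda) (x) L(S, mu) for every
    interval S' = {r, ..., n'} with n' >= n. What can fail is that it generates: for S' = {1} and
    two natural modules, e_1 (x) e_1 generates the symmetric square only. Having d + e letters in S'
    repairs this, whence k = n + d + e. Lastly, the given isomorphism over gl_{S'} forces every
    summand to have degree d + e, because the grading operator lies in gl_{S'}. *)

Section Subspaces.
Context {K : fieldType}.

Lemma span_sub (V : lmodType K) (X : V -> Prop) (N : subspace V) v :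
  (forall x, X x -> N x) -> span X v -> N v.
Proof. by move=> XN; apply. Qed.

Lemma span_ind (V : lmodType K) (X P : V -> Prop) : P 0 ->
  (forall a u v, P u -> P v -> P (a *: u + v)) -> (forall x, X x -> P x) ->
  forall v, span X v -> P v.
Proof. by move=> P0 PD PX v /(_ (Subspace P0 PD)); apply. Qed.

Lemma span_linear (V W : lmodType K) (f : {linear V -> W}) (X : V -> Prop)
  (N : subspace W) : (forall x, X x -> N (f x)) -> forall v, span X v -> N (f v).
Proof.
move=> XN; apply: span_ind => //; first by rewrite linear0; apply: subspace0.
by move=> a u v Nu Nv; rewrite linearP; apply: subspaceP.
Qed.

Fact zero_sub0 (V : lmodType K) : (0 : V) = 0. Proof. by []. Qed.
Fact zero_subP (V : lmodType K) (a : K) (u v : V) : u = 0 -> v = 0 -> a *: u + v = 0.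
Proof. by move=> -> ->; rewrite scaler0 addr0. Qed.
Definition zero_sub (V : lmodType K) : subspace V :=
  Subspace (@zero_sub0 V) (@zero_subP V).

Fact line_sub0 (V : lmodType K) (v : V) : exists a : K, 0 = a *: v.
Proof. by exists 0; rewrite scale0r. Qed.
Fact line_subP (V : lmodType K) (v : V) (a : K) (x y : V) :
  (exists b, x = b *: v) -> (exists b, y = b *: v) ->
  exists b : K, a *: x + y = b *: v.
Proof.
by move=> [b ->] [c ->]; exists (a * b + c); rewrite scalerDl scalerA.
Qed.
Definition line (V : lmodType K) (v : V) : subspace V :=
  Subspace (line_sub0 v) (line_subP (v := v)).

Section Image.
Context (V W : lmodType K) (f : V -> W) (f_lin : linear f).
Fact im_sub0 : exists v, 0 = f v.
Proof.
exists 0; have := f_lin (-1) 0 0.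
by rewrite scaler0 addr0 scaleN1r addNr.
Qed.
Fact im_subP a x y : (exists v, x = f v) -> (exists v, y = f v) ->
  exists v, a *: x + y = f v.
Proof. by move=> [u ->] [v ->]; exists (a *: u + v); rewrite f_lin. Qed.
Definition im_sub : subspace W :=
  @Subspace _ W (fun w => exists v, w = f v) im_sub0 im_subP.
End Image.
End Subspaces.

Section LinFun.
Context {K : fieldType} {V W : lmodType K} (f : V -> W) (f_lin : linear f).
Lemma lin0 : f 0 = 0.
Proof.
by have := f_lin (-1) 0 0; rewrite scaler0 addr0 scaleN1r addNr.
Qed.
Lemma linD u v : f (u + v) = f u + f v.
Proof. by have := f_lin 1 u v; rewrite !scale1r. Qed.
Lemma linZ a v : f (a *: v) = a *: f v.
Proof. by have := f_lin a v 0; rewrite !addr0 lin0 addr0. Qed.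
Lemma linB u v : f (u - v) = f u - f v.
Proof. by rewrite linD -scaleN1r linZ scaleN1r. Qed.
End LinFun.

Section ActTheory.
Context {K : fieldType} {L : lieAlgType K} {V : lieModType L}.
Implicit Types (x y : L) (v : V).

Lemma act0l v : act (0 : L) v = 0.
Proof. by have := actDl (-1) 0 0 v; rewrite scaler0 addr0 scaleN1r addNr. Qed.
Lemma actZl a x v : act (a *: x) v = a *: act x v.
Proof. by have := actDl a x 0 v; rewrite !addr0 act0l addr0. Qed.
Lemma actDl1 x y v : act (x + y) v = act x v + act y v.
Proof. by have := actDl 1 x y v; rewrite !scale1r. Qed.
Lemma act_suml (I : Type) (s : seq I) (P : pred I) (F : I -> L) v :
  act (\sum_(i <- s | P i) F i) v = \sum_(i <- s | P i) act (F i) v.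
Proof.
elim/big_rec2: _ => [|i u w _ <-]; first exact: act0l.
exact: actDl1.
Qed.
Lemma act_comm x y v : act x (act y v) = act y (act x v) + act (bracket x y) v.
Proof. by rewrite act_bracket addrC subrK. Qed.
End ActTheory.

Section ProductModule.
Context {K : fieldType} {L : lieAlgType K} (V W : lieModType L).

Definition prod_act (x : L) (p : V * W) : V * W := (act x p.1, act x p.2).

Fact prod_actDl a x y p : prod_act (a *: x + y) p = a *: prod_act x p + prod_act y p.
Proof. by rewrite /prod_act !actDl. Qed.
Fact prod_actDr a x p q : prod_act x (a *: p + q) = a *: prod_act x p + prod_act x q.
Proof. by rewrite /prod_act !actDr. Qed.
Fact prod_act_bracket x y p : prod_act (bracket x y) p
  = prod_act x (prod_act y p) - prod_act y (prod_act x p).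
Proof. by rewrite /prod_act !act_bracket. Qed.

Definition prodm : Type := (V * W)%type.
HB.instance Definition _ := GRing.Lmodule.on prodm.
HB.instance Definition _ := Lmodule_isLieModule.Build K L prodm
  prod_actDl prod_actDr prod_act_bracket.
End ProductModule.

Section Graph.
Context {K : fieldType} {L : lieAlgType K} {V W : lieModType L}.
Context (X : subspace (prodm V W)) (X_sub : submodule X).

Fact left_ker0 : X (0, 0). Proof. exact: (subspace0 X). Qed.
Fact left_kerP a u v : X (u, 0) -> X (v, 0) -> X (a *: u + v, 0).
Proof.
move=> Xu Xv; have : X (a *: u + v, a *: 0 + 0) := subspaceP a Xu Xv.
by rewrite scaler0 addr0.
Qed.
Definition left_ker : subspace V :=
  @Subspace _ V (fun v => X (v, 0)) left_ker0 left_kerP.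

Fact right_kerP a u v : X (0, u) -> X (0, v) -> X (0, a *: u + v).
Proof.
move=> Xu Xv; have : X (a *: 0 + 0, a *: u + v) := subspaceP a Xu Xv.
by rewrite scaler0 addr0.
Qed.
Definition right_ker : subspace W :=
  @Subspace _ W (fun v => X (0, v)) left_ker0 right_kerP.

Lemma left_ker_sub : submodule left_ker.
Proof. by move=> x v /(X_sub x); rewrite /= /act /= /prod_act /= linear0. Qed.
Lemma right_ker_sub : submodule right_ker.
Proof. by move=> x v /(X_sub x); rewrite /= /act /= /prod_act /= linear0. Qed.

Fact left_im0 : exists w, X (0, w). Proof. by exists 0; apply: left_ker0. Qed.
Fact left_imP a u v : (exists w, X (u, w)) -> (exists w, X (v, w)) ->
  exists w, X (a *: u + v, w).
Proof. by move=> [w Xw] [w' Xw']; exists (a *: w + w'); apply: (subspaceP a Xw Xw'). Qed.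
Definition left_im : subspace V :=
  @Subspace _ V (fun v => exists w, X (v, w)) left_im0 left_imP.
Fact right_im0 : exists v, X (v, 0). Proof. by exists 0; apply: left_ker0. Qed.
Fact right_imP a u v : (exists w, X (w, u)) -> (exists w, X (w, v)) ->
  exists w, X (w, a *: u + v).
Proof. by move=> [w Xw] [w' Xw']; exists (a *: w + w'); apply: (subspaceP a Xw Xw'). Qed.
Definition right_im : subspace W :=
  @Subspace _ W (fun v => exists w, X (w, v)) right_im0 right_imP.
Lemma left_im_sub : submodule left_im.
Proof. by move=> x v [w /(X_sub x)]; exists (act x w). Qed.
Lemma right_im_sub : submodule right_im.
Proof. by move=> x v [w /(X_sub x)]; exists (act x w). Qed.

(** A full left image makes the relation total and a zero right kernel makes it single-valued;
    closure under the module operations is then linearity and equivariance. *)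
Lemma graph_hom : (forall v, left_im v) -> (forall w, right_ker w -> w = 0) ->
  exists f : V -> W, lie_hom f /\ forall v w, X (v, w) <-> f v = w.
Proof.
move=> Xv Xw; have uniq v w w' : X (v, w) -> X (v, w') -> w = w'.
  move=> Xw1 Xw2; apply/eqP; rewrite -subr_eq0; apply/eqP/Xw.
  have : X (v - v, w - w') := subspaceB Xw1 Xw2.
  by rewrite subrr.
pose f v := projT1 (cid (Xv v)).
have Xf v : X (v, f v) by rewrite /f; case: (cid _).
exists f; split=> [|v w]; last by split=> [|<-//]; apply: uniq.
split=> [a u v|x v]; first exact: uniq (Xf _) (subspaceP a (Xf u) (Xf v)).
exact: uniq (Xf _) (X_sub x (Xf v)).
Qed.

Lemma graph_iso : (forall v, left_im v) -> (forall w, right_im w) ->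
  (forall v, left_ker v -> v = 0) -> (forall w, right_ker w -> w = 0) ->
  lie_iso V W.
Proof.
move=> Xl Xr kl kr; have [f [f_hom Xf]] := graph_hom Xl kr.
exists f; split=> //; pose g w := projT1 (cid (Xr w)).
have Xg w : X (g w, w) by rewrite /g; case: (cid _).
exists g => [v|w]; last exact/Xf.
apply/eqP; rewrite -subr_eq0; apply/eqP/kl.
have /Xf Xv : f v = f v by [].
have : X (g (f v) - v, f v - f v) := subspaceB (Xg (f v)) Xv.
by rewrite subrr.
Qed.
End Graph.

(** The sum of the eigenspaces of [D] for c - 1, c - 2, ...; the successor in [j.+1] excludes c
    itself. *)
Definition low (K : fieldType) (L : lieAlgType K) (V : lieModType L) (D : L) (c : K) :
  subspace V := span (fun x => exists j : nat, act D x = (c - j.+1%:R) *: x).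
Arguments low {K L V} D c.

Section Low.
Context {K : numFieldType} {L : lieAlgType K} {V : lieModType L} (D : L) (c : K).
Implicit Types v x : V.

(** The product of the operators D - (c - j) for 1 <= j <= J. A given element of [low D c] is killed
    once J is large, and the eigenspace of c is multiplied by J!. *)
Fixpoint low_proj (J : nat) v : V :=
  if J is J'.+1 then act D (low_proj J' v) - (c - J%:R) *: low_proj J' v else v.

Lemma low_proj_linear J : linear (low_proj J).
Proof.
elim: J => //= J IH a u v; rewrite IH actDr scalerDr scalerBr !scalerA.
by rewrite opprD addrACA [_ * a]mulrC.
Qed.

Lemma low_proj_stable (N : subspace V) J v :
  (forall u, N u -> N (act D u)) -> N v -> N (low_proj J v).
Proof.
move=> DN Nv; elim: J => //= J IH.
by apply: subspaceB; [apply: DN | apply: subspaceZ].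
Qed.

Lemma low_proj_eig J v b : act D v = b *: v ->
  low_proj J v = (\prod_(i < J) (b - (c - i.+1%:R))) *: v.
Proof.
move=> Dv; elim: J => [|J /= ->]; first by rewrite big_ord0 scale1r.
rewrite linearZ_LR /= Dv big_ord_recr /= !scalerA -scalerBl.
by rewrite [(c - _) * _]mulrC -mulrBr.
Qed.

Lemma low_proj_low v : low D c v -> exists J, forall J', (J <= J')%N -> low_proj J' v = 0.
Proof.
move: v; apply: span_ind => [|a u v [J hJ] [J' hJ']|x [j Dx]].
- by exists 0%N => J _; apply: lin0 (low_proj_linear J).
- exists (maxn J J') => M; rewrite geq_max => /andP[h h'].
  by rewrite low_proj_linear hJ // hJ' // scaler0 addr0.
exists j.+1 => J jJ; rewrite (low_proj_eig J Dx).
by rewrite (bigD1 (Ordinal jJ)) //= subrr mul0r scale0r.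
Qed.

(** For large J, [low_proj J] kills x, preserves N and multiplies v by J!, which is invertible in
    characteristic zero. *)
Lemma low_extract (N : subspace V) v x : (forall u, N u -> N (act D u)) ->
  act D v = c *: v -> low D c x -> N (v + x) -> N v.
Proof.
move=> DN Dv /low_proj_low[J hJ] /(low_proj_stable J DN).
rewrite (linD (low_proj_linear J)) hJ // addr0 (low_proj_eig J Dv).
set a := \prod_(_ < _) _; have a0 : a != 0.
  apply/prodf_neq0 => i _; by rewrite opprB addrC subrK pnatr_eq0.
by move/(subspaceZ a^-1); rewrite scalerA mulVf ?scale1r.
Qed.

Lemma low_eig0 v : act D v = c *: v -> low D c v -> v = 0.
Proof.
move=> Dv lv; apply: (@low_extract (zero_sub V) v (- v)) => //.
- by move=> u ->; rewrite linear0.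
- exact: subspaceN.
by rewrite subrr; apply: subspace0.
Qed.
End Low.

Section Closure.
Context {K : fieldType} {L : lieAlgType K} {V : lieModType L}.
Context (A : L -> Prop) (N0 : subspace V).

Definition closure_set (v : V) : Prop := forall N : subspace V,
  (forall u, N0 u -> N u) -> (forall a u, A a -> N u -> N (act a u)) -> N v.
Fact closure0 : closure_set 0. Proof. by move=> N _ _; apply: subspace0. Qed.
Fact closureP a u v : closure_set u -> closure_set v -> closure_set (a *: u + v).
Proof. by move=> hu hv N h h'; apply: subspaceP; [apply: hu | apply: hv]. Qed.
Definition closure : subspace V := Subspace closure0 closureP.

Lemma sub_closure v : N0 v -> closure v. Proof. by move=> Nv N NN _; apply: NN. Qed.
Lemma closure_act a v : A a -> closure v -> closure (act a v).
Proof. by move=> Aa cv N h h'; exact: h' Aa (cv N h h'). Qed.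

Context (B : L -> Prop) (AB : forall x, span (fun y => A y \/ B y) x).
Hypothesis BN0 : forall b v, B b -> N0 v -> N0 (act b v).

(* Poincare-Birkhoff-Witt in its simplest form: elements of B are moved to the
   right of elements of A, at the cost of a commutator. *)
Lemma closure_submodule : submodule closure.
Proof.
suff h v : closure v -> closure v /\ forall x, closure (act x v).
  by move=> x v /h[].
have hS0 : closure 0 /\ forall x : L, closure (act x (0 : V)).
  by split=> [|x]; rewrite ?linear0; apply: subspace0.
have hSP a u w : (closure u /\ forall x : L, closure (act x u)) ->
    (closure w /\ forall x : L, closure (act x w)) ->
    closure (a *: u + w) /\ forall x : L, closure (act x (a *: u + w)).
  move=> [cu hu] [cv hv]; split=> [|x]; first exact: subspaceP.
  by rewrite actDr; apply: subspaceP.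
move=> /(_ (Subspace hS0 hSP)); apply.
  move=> u Nu; split=> [|x]; first exact: sub_closure.
  move: x (AB x); apply: span_ind => [|a x y hx hy|x [Ax|Bx]].
  - by rewrite act0l; apply: subspace0.
  - by rewrite actDl; apply: subspaceP.
  - by apply: closure_act => //; apply: sub_closure.
  - exact/sub_closure/(BN0 Bx).
move=> a u Aa [cu hu]; split=> [|x]; first exact: closure_act.
by rewrite act_comm; apply: subspaceD => //; apply: closure_act.
Qed.

Lemma closure_ind (P : V -> Prop) : P 0 ->
  (forall a u v, P u -> P v -> P (a *: u + v)) -> (forall v, N0 v -> P v) ->
  (forall a v, A a -> P v -> P (act a v)) -> forall v, closure v -> P v.
Proof. by move=> P0 PD PN PA v /(_ (Subspace P0 PD)); apply. Qed.

Context (D : L) (c : K).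
Hypothesis AD : forall a, A a -> exists j : nat, bracket D a = - (j.+1%:R) *: a.
Hypothesis DN0 : forall v, N0 v -> act D v = c *: v.

Lemma low_act a (v : V) : A a -> low D c v -> low D c (act a v).
Proof.
move=> Aa; apply: (@span_linear _ _ _ (act a)) => x [j Dx].
have [k Da] := AD Aa; apply: sub_span; exists (j + k).+1.
rewrite act_comm Dx Da actZl linearZ_LR -scalerDl; congr (_ *: _).
by rewrite -addrA -opprD -natrD addSn addnS.
Qed.

(** N0 lies in degree c and each element of A lowers the degree by a positive integer, so that only
    the empty word in A contributes in degree c. *)
Lemma closure_low v : closure v -> exists2 v0, N0 v0 & low D c (v - v0).
Proof.
move: v; apply: closure_ind => [|a u v [u0 Nu lu] [v0 Nv lv]|v Nv|a v Aa [v0 Nv lv]].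
- by exists 0; [apply: subspace0 | rewrite subrr; apply: subspace0].
- exists (a *: u0 + v0); first exact: subspaceP.
  by rewrite opprD addrACA -scalerBr; apply: subspaceP.
- by exists v => //; rewrite subrr; apply: subspace0.
exists 0; first exact: subspace0.
rewrite subr0 -[v](subrK v0) linearD; apply: subspaceD; first exact: low_act.
have [k Da] := AD Aa; apply: sub_span; exists k.
by rewrite act_comm (DN0 Nv) Da actZl linearZ_LR -scalerDl.
Qed.
End Closure.

(** * Weights *)

Section Restriction.
Context {K : fieldType} {L : lieAlgType K} (P : lieSub L) (V : lieModType L).

Definition restr : Type := V.
HB.instance Definition _ := GRing.Lmodule.on restr.
Definition restr_act (x : P) (v : restr) : restr := act (lsval x) (v : V).
Fact restr_actDl a x y v :
  restr_act (a *: x + y) v = a *: restr_act x v + restr_act y v.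
Proof. exact: actDl. Qed.
Fact restr_actDr a x u v :
  restr_act x (a *: u + v) = a *: restr_act x u + restr_act x v.
Proof. exact: actDr. Qed.
Fact restr_act_bracket x y v : restr_act (bracket x y) v
  = restr_act x (restr_act y v) - restr_act y (restr_act x v).
Proof. exact: act_bracket. Qed.
HB.instance Definition _ := Lmodule_isLieModule.Build K P restr
  restr_actDl restr_actDr restr_act_bracket.
End Restriction.

Section BracketSums.
Context {K : fieldType} {L : lieAlgType K}.
Implicit Types (x y : L).

Lemma bracket0l x : bracket (0 : L) x = 0.
Proof. by have := bracketDl (-1) 0 0 x; rewrite scaler0 addr0 scaleN1r addNr. Qed.

Lemma bracket_suml (I : Type) (s : seq I) (a : I -> K) (F : I -> L) y :
  bracket (\sum_(i <- s) a i *: F i) y = \sum_(i <- s) a i *: bracket (F i) y.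
Proof.
elim: s => [|i s IH]; first by rewrite !big_nil bracket0l.
by rewrite !big_cons bracketDl IH.
Qed.

Lemma sum_delta (V : lmodType K) (I : eqType) (s : seq I) (a : I -> K) j (v : V) :
  uniq s -> (j \notin s -> a j = 0) ->
  \sum_(i <- s) a i *: (if i == j then v else 0) = a j *: v.
Proof.
move=> us a0; have [js|/[dup] js /a0 ->] := boolP (j \in s).
  rewrite (bigD1_seq j) //= eqxx big1 ?addr0 // => i /negPf ->.
  by rewrite scaler0.
rewrite scale0r big_seq big1 // => i si.
by case: eqP si js => [-> ->|_ _ _] //; rewrite scaler0.
Qed.

Lemma bracket_sum_delta (I : eqType) (s : seq I) (a : I -> K) (e : I -> L) j k y :
  uniq s -> (j \notin s -> a j = 0) -> (k \notin s -> a k = 0) ->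
  (forall i, bracket (e i) y = (if i == j then y else 0) - (if i == k then y else 0)) ->
  bracket (\sum_(i <- s) a i *: e i) y = (a j - a k) *: y.
Proof.
move=> us aj ak ey; rewrite bracket_suml scalerBl.
rewrite -(sum_delta y us aj) -(sum_delta y us ak) -sumrB.
by apply: eq_bigr => i _; rewrite ey scalerBr.
Qed.
End BracketSums.

Section MatrixUnits.
Context {K : numFieldType}.
Implicit Types (S : {pred int}) (c : int -> nat) (l : seq int).

Lemma bracketE m n r s : bracket (gE m n) (gE r s) =
  (if n == r then gE m s else 0) - (if m == s then gE r n else 0) :> glinf K.
Proof. exact: glbracketE. Qed.

Lemma act_gE_comm (V : lieModType (glinf K)) m n r s (v : V) :
  act (gE m n) (act (gE r s) v) = act (gE r s) (act (gE m n) v) +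
  ((if n == r then act (gE m s) v else 0) - (if m == s then act (gE r n) v else 0)).
Proof.
rewrite act_comm bracketE actDl1 -scaleN1r actZl scaleN1r.
by congr (_ + (_ - _)); case: ifP; rewrite ?act0l.
Qed.

(* The degree operator with respect to which E_{m,n} has degree c m - c n. *)
Definition degE c l : glinf K := \sum_(i <- l) (c i)%:R *: gE i i.

(** As c vanishes off l, [degE c l] is the whole diagonal matrix with entries c i; hence p and q may
    be arbitrary. *)
Lemma degE_bracket c l p q : uniq l -> (forall i, i \notin l -> c i = 0%N) ->
  bracket (degE c l) (gE p q) = ((c p)%:R - (c q)%:R) *: gE p q.
Proof.
move=> ul c0.
apply: (@bracket_sum_delta K (glinf K) _ l (fun i => (c i)%:R)) => // [/c0->|/c0->|i] //.
rewrite bracketE; congr (_ - _); first by case: eqP => [->|].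
by case: eqP => [->|].
Qed.

Lemma degE_lower c p q : (c p < c q)%N ->
  exists j : nat, (c p)%:R - (c q)%:R = - (j.+1%:R) :> K.
Proof.
move=> pq; exists (c q - (c p).+1)%N.
by rewrite subnSK // natrB ?opprB // ltnW.
Qed.

Lemma degE_act (V : lieModType (glinf K)) c l (f : int -> K) (v : V) :
  (forall i, i \in l -> act (gE i i) v = f i *: v) ->
  act (degE c l) v = (\sum_(i <- l) (c i)%:R * f i) *: v.
Proof.
move=> fv; rewrite act_suml scaler_suml [LHS]big_seq [RHS]big_seq.
by apply: eq_bigr => i il; rewrite actZl fv // scalerA.
Qed.

(** Passing through the projection [corner_fun] makes this total in m and n, without membership
    proofs; it is zero unless m and n both lie in S. *)
Definition unitS S m n : glS S := @LieSubEl K _ (glS S) _ (corner_fun_in S (gE m n)).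

Lemma val_unitS S m n : m \in S -> n \in S -> lsval (unitS S m n) = gE m n.
Proof. by move=> mS nS; rewrite /= corner_funE /relS mS nS. Qed.

Lemma glS_ind S (P : glS S -> Prop) : P 0 ->
  (forall a u v, P u -> P v -> P (a *: u + v)) ->
  (forall m n, m \in S -> n \in S -> P (unitS S m n)) -> forall x, P x.
Proof.
move=> P0 PD PE [x hx].
suff [h] : exists h : x \in lieSub_pred (glS S), P (LieSubEl h).
  by rewrite (bool_irrelevance h hx).
elim/(@glspan_ind K (relS S)): (hx) => [|a u v [hu Pu] [hv Pv]|m n /andP[mS nS]].
- exists (glspan0 _); set z := LieSubEl _; suff -> : z = 0 by [].
  exact/val_inj.
- exists (glspanD a hu hv); set z := LieSubEl _.
  suff -> : z = a *: LieSubEl hu + LieSubEl hv by apply: PD.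
  exact/val_inj.
have mn : relS S m n by rewrite /relS mS.
exists (glspan_E mn); set z := LieSubEl _.
suff -> : z = unitS S m n by apply: PE.
by apply/val_inj; rewrite [RHS]val_unitS.
Qed.

Definition degS S c l : glS S := @LieSubEl K _ (glS S) _ (corner_fun_in S (degE c l)).

Lemma degSE S c l : degS S c l = \sum_(i <- l) (c i)%:R *: unitS S i i.
Proof.
apply/val_inj; rewrite raddf_sum [LHS]linear_sum; apply: eq_bigr => i _.
exact: linearZ_LR.
Qed.

Lemma val_degS S c l : {subset l <= S} -> lsval (degS S c l) = degE c l.
Proof.
move=> lS; rewrite /= /degE linear_sum big_seq [RHS]big_seq.
apply: eq_bigr => i /lS iS; rewrite linearZ_LR /=.
by rewrite -[corner_fun S _]/(lsval (unitS S i i)) val_unitS.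
Qed.
End MatrixUnits.

Section Weights.
Context {K : numFieldType}.
Implicit Types (V W : lieModType (glinf K)) (s : seq int).

(* The weight encoded by s takes the value [count_mem i s] on E_{i,i}. *)
Definition wt V s (x : V) : Prop :=
  forall i, act (gE i i) x = (count_mem i s)%:R *: x.
Arguments wt {V} s x.

Definition polymod (d : nat) V : Prop :=
  forall v : V, span (fun x => exists2 s, size s = d & wt s x) v.

Lemma wt_lin V s a (x y : V) : wt s x -> wt s y -> wt s (a *: x + y).
Proof. by move=> sx sy i; rewrite actDr sx sy scalerDr !scalerA mulrC. Qed.

Lemma weight_gE V (f : int -> K) (x : V) m n :
  (forall i, act (gE i i) x = f i *: x) ->
  forall i, act (gE i i) (act (gE m n) x)
    = (f i + (i == m)%:R - (i == n)%:R) *: act (gE m n) x.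
Proof.
move=> fx i; rewrite act_gE_comm fx linearZ_LR -addrA scalerDl; congr (_ + _).
rewrite scalerBl; congr (_ - _).
  by case: eqP => [->|_]; rewrite ?scale1r ?scale0r.
by case: eqP => [->|_]; rewrite ?scale1r ?scale0r.
Qed.

(** Write v as a sum of weight vectors, of as few as possible. If v does not have the weight s of
    the first summand, some E_{i,i} minus its eigenvalue for s does not kill v; it kills that
    summand, preserves N and only rescales the others, which leaves a shorter sum. *)
Lemma weight_vector_exists d V (N : subspace V) v : polymod d V ->
  (forall i u, N u -> N (act (gE i i) u)) -> N v -> v <> 0 ->
  exists x s, [/\ N x, x <> 0, size s = d & wt s x].
Proof.
move=> polyV stN Nv v0.
pose W := fun x : V => exists2 s, size s = d & wt s x.
have [l lW vE] : exists2 l : seq V, forall x, x \in l -> W x & v = \sum_(x <- l) x.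
  move: v (polyV v) {Nv v0}; apply: span_ind => [|a u v [l lW ->] [l' lW' ->]|x Wx].
  - by exists [::]; rewrite ?big_nil.
  - exists ([seq a *: x | x <- l] ++ l').
      move=> x; rewrite mem_cat => /orP[/mapP[y /lW[s sd sy] ->]|/lW'//].
      exists s => //; rewrite -[_ *: _]addr0; apply: wt_lin => // i.
      by rewrite linear0 scaler0.
    by rewrite big_cat big_map -scaler_sumr.
  - by exists [:: x]; rewrite ?big_seq1 // => y; rewrite inE => /eqP ->.
have [k kl] : exists k, (size l <= k)%N by exists (size l).
elim: k l kl v Nv v0 lW vE => [|k IH] [|y l] // kl v Nv v0 lW vE;
  do 1?by case: v0; rewrite vE big_nil.
have [s sd sy] := lW y (mem_head _ _).
have [sv|] := EM (wt s v); first by exists v, s.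
move=> /existsNP[i /eqP]; rewrite -subr_eq0 => /eqP ne0.
pose f (x : V) := act (gE i i) x - (count_mem i s)%:R *: x.
have f_lin : linear f.
  move=> a u w; rewrite /f actDr scalerDr scalerBr !scalerA.
  by rewrite opprD addrACA [_ * a]mulrC.
apply: (IH [seq f x | x <- l] _ (f v)) => //.
- by rewrite size_map.
- by apply: subspaceB; [apply: stN | apply: subspaceZ].
- move=> x /mapP[z zl ->]; have [|t td tz] := lW z; first by rewrite inE zl orbT.
  exists t => //; rewrite /f tz -scalerBl -[_ *: _]addr0.
  by apply: wt_lin => // j; rewrite linear0 scaler0.
rewrite big_map vE big_cons (linD f_lin) /f sy subrr add0r.
elim: l {kl lW vE IH} => [|z l IH]; first by rewrite !big_nil; apply: (lin0 f_lin).
by rewrite !big_cons -IH -(linD f_lin).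
Qed.

Lemma weight_is_wt d V (f : int -> K) (x : V) : polymod d V -> x <> 0 ->
  (forall i, act (gE i i) x = f i *: x) ->
  exists2 s, size s = d & forall i, f i = (count_mem i s)%:R.
Proof.
move=> polyV x0 fx.
have [||y [s [[a ->] y0 sd sy]]] := @weight_vector_exists d V (line x) x polyV _ _ x0.
- by move=> i u [a ->]; exists (a * f i); rewrite linearZ_LR /= fx scalerA.
- by exists 1; rewrite scale1r.
exists s => // i; have := sy i; rewrite linearZ_LR /= fx !scalerA [_ * a]mulrC => /eqP.
rewrite -subr_eq0 -scalerBl -mulrBr -scalerA scaler_eq0 => /orP[/eqP a0|].
  by case: y0; rewrite a0 scale0r.
by rewrite scaler_eq0 subr_eq0 => /orP[/eqP//|/eqP].
Qed.

(** If n is not in s and m differs from n, a nonzero image would have eigenvalue -1 under E_{n,n},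
    which is no multiplicity; if m = n the eigenvalue of x is 0. *)
Lemma wt_gE d V s (x : V) m n : polymod d V -> wt s x ->
  if n \in s then wt (m :: rem n s) (act (gE m n) x) else act (gE m n) x = 0.
Proof.
move=> polyV sx; have wE := weight_gE m n sx.
case: ifP => ns.
  move=> i; rewrite wE; congr (_ *: _); rewrite /= count_rem ns /=.
  rewrite [m == i]eq_sym [n == i]eq_sym; case: (eqVneq i n) => [->|_].
    rewrite natrD natrB; last by rewrite -has_count has_pred1.
    by rewrite addrA [X in X - _]addrC.
  by rewrite subr0 subn0 addrC natrD.
have [//|/eqP y0] := eqVneq (act (gE m n) x) 0.
have [t td tE] := weight_is_wt polyV y0 wE.
have := tE n; rewrite eqxx (count_memPn (negbT ns)) add0r.
have [mn _|nm] := eqVneq n m; first by rewrite -mn sx (count_memPn (negbT ns)) scale0r.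
move/eqP; rewrite eq_sym -subr_eq0 sub0r opprK -[1]/(1%:R) -natrD.
by rewrite pnatr_eq0 addn1.
Qed.

(** The bound is strict because the list to be avoided is a weight with one letter removed: that
    letter lies outside T, so it is avoided anyway. Thus d elements of T suffice. *)
Definition roomy (T : {pred int}) (d : nat) : Prop :=
  forall s, (size s < d)%N -> exists2 m, m \in T & m \notin s.

Section Moving.
Context {d : nat} {V : lieModType (glinf K)} (polyV : polymod d V).
Context {T : {pred int}} (roomT : roomy T d).

(* As m does not occur in the weight of x, E_{n,m} kills x, so that
   E_{n,m} E_{m,n} x = (E_{n,n} - E_{m,m}) x is a nonzero multiple of x. *)
Lemma move_step s (x : V) n : wt s x -> size s = d -> n \in s -> n \notin T ->
  exists m, [/\ m \in T, wt (m :: rem n s) (act (gE m n) x) &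
    act (gE n m) (act (gE m n) x) = (count_mem n s)%:R *: x].
Proof.
move=> sx sd ns nT; have [|m mT ms] := roomT (s := rem n s).
  by rewrite size_rem // sd ltn_predL -sd; case: (s) ns.
have mn : m != n by apply: contraNneq nT => <-.
have {}ms : m \notin s.
  apply: contra ms => ms; rewrite -has_pred1 has_count count_rem ns /=.
  by rewrite [n == m]eq_sym (negPf mn) subn0 -has_count has_pred1.
exists m; split=> //; first by have := wt_gE m n polyV sx; rewrite ns.
have := wt_gE n m polyV sx; rewrite (negPf ms) => x0.
by rewrite act_gE_comm !eqxx x0 linear0 add0r !sx (count_memPn ms) scale0r subr0.
Qed.

Lemma move_out s : ~~ all (mem T) s ->
  exists n, [/\ n \in s, n \notin T & forall m, m \in T ->
    (count (predC (mem T)) (m :: rem n s) < count (predC (mem T)) s)%N].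
Proof.
move=> /allPn[n ns nT]; exists n; split=> // m mT.
rewrite /= mT add0n count_rem ns /= [in X in (_ - X)%N]nT subn1 prednK //.
by rewrite -has_count; apply/hasP; exists n.
Qed.

(** Each move lowers the number of letters outside T, and as it can be undone up to a nonzero
    factor, it never produces zero. *)
Lemma move_meet (N : subspace V) s x : submodule N -> wt s x -> size s = d ->
  N x -> x <> 0 -> exists y t, [/\ N y, y <> 0, size t = d, wt t y & all (mem T) t].
Proof.
move=> subN; have [k] := ubnP (count (predC (mem T)) s).
elim: k s x => // k IH s x ltk sx sd Nx x0.
have [sT|/move_out[n [ns nT lt]]] := boolP (all (mem T) s); first by exists x, s.
have [m [mT sy yE]] := move_step sx sd ns nT.
apply: (IH _ _ _ sy); first exact: leq_trans (lt m mT) _.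
- by rewrite /= size_rem // prednK //; case: (s) ns.
- exact: subN.
move=> y0; move: yE; rewrite y0 linear0 => /esym/eqP.
by rewrite scaler_eq0 pnatr_eq0 => /orP[/eqP/count_memPn|/eqP//]; rewrite ns.
Qed.

Lemma move_generate (N : subspace V) : submodule N ->
  (forall s x, wt s x -> size s = d -> all (mem T) s -> N x) -> forall v, N v.
Proof.
move=> subN NT v; apply: span_sub (polyV v) => x [s sd sx].
have [k] := ubnP (count (predC (mem T)) s).
elim: k s sd x sx => // k IH s sd x sx ltk.
have [sT|/move_out[n [ns nT lt]]] := boolP (all (mem T) s); first exact: NT sx _ _.
have [m [mT sy yE]] := move_step sx sd ns nT.
have c0 : (count_mem n s)%:R != 0 :> K.
  by rewrite pnatr_eq0; apply/eqP => /count_memPn; rewrite ns.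
rewrite -[x]scale1r -(mulVf c0) -scalerA -yE; apply/subspaceZ/subN.
apply: (IH _ _ _ sy); last exact: leq_trans (lt m mT) _.
by rewrite /= size_rem // prednK //; case: (s) ns.
Qed.
End Moving.

Lemma act_pure (L : lieAlgType K) (V W : lieModType L) (x : L) (v : V) (w : W) :
  act x (tensor_pure v w : tensor V W)
  = tensor_pure (act x v) w + tensor_pure v (act x w).
Proof. exact: tensor_act_pure. Qed.

Lemma pureZl (L : lieAlgType K) (V W : lieModType L) a (v : V) (w : W) :
  tensor_pure (a *: v) w = a *: tensor_pure v w :> tensor V W.
Proof. exact: (linZ (fun a u v => tensor_pureDl a u v w)). Qed.
Lemma pureZr (L : lieAlgType K) (V W : lieModType L) a (v : V) (w : W) :
  tensor_pure v (a *: w) = a *: tensor_pure v w :> tensor V W.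
Proof. exact: (linZ (fun a u w => tensor_pureDr a v u w)). Qed.
Lemma pure0l (L : lieAlgType K) (V W : lieModType L) (w : W) :
  tensor_pure (0 : V) w = 0 :> tensor V W.
Proof. exact: (lin0 (fun a u v => tensor_pureDl a u v w)). Qed.
Lemma pure0r (L : lieAlgType K) (V W : lieModType L) (v : V) :
  tensor_pure v (0 : W) = 0 :> tensor V W.
Proof. exact: (lin0 (fun a u w => tensor_pureDr a v u w)). Qed.

Lemma polymod_tensor d e V W :
  polymod d V -> polymod e W -> polymod (d + e) (tensor V W).
Proof.
move=> polyV polyW; move=> u.
pose X := fun x : tensor V W => exists2 s, size s = (d + e)%N & wt s x.
apply: (@tensor_ind _ _ V W (fun u => span X u)) => {u}.
- exact: subspace0.
- by move=> a u v; apply: subspaceP.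
move=> v w; move: v (polyV v).
apply: span_ind => [|a v v' Xv Xv'|v [s sd sv]].
- by rewrite pure0l; apply: subspace0.
- by rewrite tensor_pureDl; apply: subspaceP.
move: w (polyW w); apply: span_ind => [|a w w' Xw Xw'|w [t td tw]].
- by rewrite pure0r; apply: subspace0.
- by rewrite tensor_pureDr; apply: subspaceP.
apply: sub_span; exists (s ++ t); first by rewrite size_cat sd td.
move=> i; rewrite act_pure sv tw pureZl pureZr -scalerDl.
by rewrite count_cat natrD.
Qed.
End Weights.
Arguments wt {K V} s x.

(** * Dominant highest weight vectors in tensor powers *)

Lemma eq_opp0 (K : numFieldType) (V : lmodType K) (u : V) : u = - u -> u = 0.
Proof.
move=> uN; apply/eqP; have : u *+ 2 == 0 by rewrite mulr2n {1}uN addNr.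
by rewrite -scaler_nat scaler_eq0 pnatr_eq0.
Qed.

(* The k-th tensor power of the natural module, on the basis of words of
   length k. *)
Section TensorPower.
Context {K : numFieldType} (k : nat).
Local Notation word := {ffun 'I_k -> int}.
Local Notation F := {malg K[word]}.
Implicit Types (f : word) (u : F) (x y : glinf K) (i j : 'I_k).

Definition upd f i m : word := [ffun j => if j == i then m else f j].

Lemma updC f i j m r : j != i -> upd (upd f i r) j m = upd (upd f j m) i r.
Proof.
move=> /negPf ji; apply/ffunP => l; rewrite !ffunE.
by case: (eqVneq l i) => [->|//]; rewrite eq_sym ji.
Qed.

Lemma updK f i m r : upd (upd f i r) i m = upd f i m.
Proof. by apply/ffunP => l; rewrite !ffunE; case: eqP. Qed.

Lemma upd_id f i : upd f i (f i) = f.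
Proof. by apply/ffunP => l; rewrite ffunE; case: eqP => // ->. Qed.

Lemma sum_upd_swap (V : zmodType) (e : word -> V) f m n r s :
  \sum_i \sum_(j | j != i) e (upd (upd f i r) j m) *+ ((f j == n) * (f i == s)) =
  \sum_i \sum_(j | j != i) e (upd (upd f i m) j r) *+ ((f j == s) * (f i == n)).
Proof.
rewrite (exchange_big_dep predT) //=; apply: eq_bigr => i _.
apply: eq_big => [j|j ij]; first by rewrite eq_sym.
by rewrite mulnC updC // eq_sym.
Qed.

Lemma subDD_eq (V : zmodType) (a b a' b' : V) : b = b' -> a + b - (a' + b') = a - a'.
Proof. by move=> ->; rewrite opprD addrACA subrr addr0. Qed.

Definition word_act (p : int * int) f : F := \sum_i << upd f i p.1 >> *+ (f i == p.2).

Definition tpow_act x u : F := malg_ext (fun p => malg_ext (word_act p) u) x.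

Lemma tpow_actDl a x y u : tpow_act (a *: x + y) u = a *: tpow_act x u + tpow_act y u.
Proof. exact: malg_ext_is_linear. Qed.
Lemma tpow_actDr a x u v : tpow_act x (a *: u + v) = a *: tpow_act x u + tpow_act x v.
Proof.
by rewrite -malg_extZ -malg_extD; apply: eq_malg_ext => p; rewrite linearP.
Qed.

Lemma tpow_actE m n u : tpow_act (gE m n) u = malg_ext (word_act (m, n)) u.
Proof. by rewrite /tpow_act gE.unlock malg_extU. Qed.
Lemma tpow_actU m n f :
  tpow_act (gE m n) << f >> = \sum_i << upd f i m >> *+ (f i == n).
Proof. by rewrite tpow_actE malg_extU. Qed.

Lemma tpow_act0l u : tpow_act 0 u = 0.
Proof. by have := tpow_actDl (-1) 0 0 u; rewrite scaler0 addr0 scaleN1r addNr. Qed.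

Lemma tpow_act_sum x (I : Type) (s : seq I) (G : I -> F) :
  tpow_act x (\sum_(i <- s) G i) = \sum_(i <- s) tpow_act x (G i).
Proof.
elim: s => [|i s IH]; first by rewrite !big_nil (lin0 (fun a => tpow_actDr a x)).
by rewrite !big_cons (linD (fun a => tpow_actDr a x)) IH.
Qed.
Lemma tpow_actMn x u b : tpow_act x (u *+ b) = tpow_act x u *+ b.
Proof. by rewrite -!scaler_nat (linZ (fun a => tpow_actDr a x)). Qed.

(** The first sum collects the pairs of operations on one and the same letter, the second those on
    two different letters. The second is symmetric in the two matrix units by [sum_upd_swap] and
    drops out of the commutator. *)
Lemma tpow_act2 m n r s f : tpow_act (gE m n) (tpow_act (gE r s) << f >>) =
  \sum_i << upd f i m >> *+ (f i == s) *+ (r == n) +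
  \sum_i \sum_(j | j != i) << upd (upd f i r) j m >> *+ ((f j == n) * (f i == s)).
Proof.
rewrite tpow_actU tpow_act_sum -big_split; apply: eq_bigr => i _ /=.
rewrite tpow_actMn tpow_actU (bigD1 i) //= mulrnDl; congr (_ + _).
  by rewrite updK ffunE eqxx -!mulrnA mulnC.
rewrite -sumrMnl; apply: eq_bigr => j /negPf ji.
by rewrite ffunE ji -mulrnA.
Qed.

Lemma tpow_act_bracketU m n r s f :
  tpow_act (bracket (gE m n) (gE r s)) << f >> =
  tpow_act (gE m n) (tpow_act (gE r s) << f >>)
  - tpow_act (gE r s) (tpow_act (gE m n) << f >>).
Proof.
have E b p q : tpow_act (if b then gE p q else 0) << f >>
    = tpow_act (gE p q) << f >> *+ (b : bool).
  by case: b; rewrite // tpow_act0l.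
rewrite bracketE -scaleN1r addrC tpow_actDl scaleN1r addrC !E !tpow_act2.
rewrite (subDD_eq _ _ (sum_upd_swap (fun f => << f >>) f m n r s)).
by rewrite !tpow_actU -!sumrMnl [n == r]eq_sym.
Qed.

Lemma tpow_act_bracket x y u : tpow_act (bracket x y) u
  = tpow_act x (tpow_act y u) - tpow_act y (tpow_act x u).
Proof.
have D a u1 u2 u3 u4 : a *: (u1 - u2) + (u3 - u4) = (a *: u1 + u3) - (a *: u2 + u4) :> F.
  by rewrite scalerBr opprD addrACA.
have A0r z : tpow_act z 0 = 0 := lin0 (fun a => tpow_actDr a z).
elim/(@gl_ind K): x => [|a x x' IH IH'|m n].
- by rewrite bracket0l !tpow_act0l A0r subrr.
- by rewrite bracketDl !tpow_actDl IH IH' D tpow_actDr.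
elim/(@gl_ind K): y => [|a y y' IH IH'|r s].
- rewrite -[bracket _ _]opprK -[X in tpow_act (- X)]scaleN1r.
  have -> : bracket (gE m n) (0 : glinf K) = 0.
    by have := bracketDr (-1) (gE m n) (0 : glinf K) 0; rewrite scaler0 addr0 scaleN1r addNr.
  by rewrite scaler0 oppr0 !tpow_act0l A0r subrr.
- by rewrite bracketDr !tpow_actDl IH IH' D tpow_actDr.
elim/(@malg_ind K word): u => [|a u v IH IH'|f].
- by rewrite !A0r subrr.
- by rewrite !tpow_actDr IH IH' D.
exact: tpow_act_bracketU.
Qed.

Definition tpow : Type := F.
HB.instance Definition _ := GRing.Lmodule.on tpow.
HB.instance Definition _ := Lmodule_isLieModule.Build K (glinf K) tpow
  tpow_actDl (fun a x u v => tpow_actDr a x u v) tpow_act_bracket.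

Lemma tpow_act_diag f (p : int) :
  tpow_act (gE p p) << f >> = << f >> *+ count_mem p (codom f).
Proof.
rewrite tpow_actU -sum1_count /codom big_image_cond.
rewrite -sumrMnr [RHS]big_mkcond; apply: eq_bigr => j _ /=; case: eqP => [fj|//].
by rewrite -fj upd_id.
Qed.

Lemma polymod_tpow : polymod k (tpow : lieModType (glinf K)).
Proof.
elim/(@malg_ind K word) => [|a u v|f]; first exact: subspace0.
  exact: subspaceP.
apply: sub_span; exists (codom f); first by rewrite size_codom card_ord.
by move=> p; rewrite scaler_nat; apply: tpow_act_diag.
Qed.

Context (r : int).
Definition perm_word (s : 'S_k) : word := [ffun i => r + (s i : nat)%:Z].

Lemma perm_wordE (s : 'S_k) i : perm_word s i = r + (s i : nat)%:Z.
Proof. by rewrite ffunE. Qed.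

(** The antisymmetric tensor of e_r, ..., e_{r+k-1}, that is, the highest weight vector of the k-th
    exterior power; for k = 0 it is the empty word. *)
Definition alt_vec : F := \sum_(s : 'S_k) (-1) ^+ s *: << perm_word s >>.

Lemma alt_vec_act m n : tpow_act (gE m n) alt_vec =
  \sum_(s : 'S_k) (-1) ^+ s *: \sum_i << upd (perm_word s) i m >> *+ (perm_word s i == n).
Proof.
rewrite tpow_act_sum; apply: eq_bigr => s _.
by rewrite (linZ (fun a => tpow_actDr a _)) tpow_actU.
Qed.

Lemma count_perm_word (s : 'S_k) p :
  count_mem p (codom (perm_word s)) = nat_of_bool (r <= p < r + k%:Z)%R.
Proof.
rewrite count_uniq_mem; last first.
  rewrite map_inj_uniq ?enum_uniq // => i j; rewrite !ffunE => /addrI [] /val_inj.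
  exact: perm_inj.
congr nat_of_bool; apply/mapP/idP => [[i _ ->]|pr].
  by rewrite ffunE; have := ltn_ord (s i); lia.
have pk : (`|p - r| < k)%N by lia.
exists (s^-1%g (Ordinal pk)); first by rewrite mem_enum.
by rewrite perm_wordE permKV /=; lia.
Qed.

Lemma alt_vec_weight (p : int) :
  tpow_act (gE p p) alt_vec = (nat_of_bool (r <= p < r + k%:Z)%R)%:R *: alt_vec.
Proof.
rewrite tpow_act_sum scaler_sumr; apply: eq_bigr => s _.
rewrite (linZ (fun a => tpow_actDr a _)) tpow_act_diag count_perm_word.
by rewrite -scaler_nat !scalerA mulrC.
Qed.

Lemma alt_vec_out m n : ~~ (r <= n < r + k%:Z) -> tpow_act (gE m n) alt_vec = 0.
Proof.
move=> nr; rewrite alt_vec_act big1 // => s _; rewrite big1 ?scaler0 // => i _.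
rewrite ffunE; case: eqP => // ni; case/negP: nr.
by have := ltn_ord (s i); lia.
Qed.

(* Replacing n by m makes two letters equal, so that the terms of s and of its
   product with a transposition cancel. *)
Lemma alt_vec_in m n : r <= m < r + k%:Z -> r <= n < r + k%:Z -> m != n ->
  tpow_act (gE m n) alt_vec = 0.
Proof.
move=> mr nr mn; have inr p : r <= p < r + k%:Z -> exists a : 'I_k, p = r + (a : nat)%:Z.
  move=> pr; have ak : (`|p - r| < k)%N by lia.
  by exists (Ordinal ak) => /=; lia.
have [a ma] := inr m mr; have [b nb] := inr n nr.
have ab : a != b by apply: contraNneq mn => ab; rewrite ma nb ab.
pose w (s : 'S_k) : word := [ffun i => if s i == b then m else r + (s i : nat)%:Z].
have -> : tpow_act (gE m n) alt_vec = \sum_(s : 'S_k) (-1) ^+ s *: << w s >>.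
  rewrite alt_vec_act; apply: eq_bigr => s _; congr (_ *: _).
  rewrite (bigD1 (s^-1%g b)) //= big1 => [|i ib].
    rewrite addr0 perm_wordE permKV nb eqxx; congr (<< _ >>); apply/ffunP => j.
    by rewrite [LHS]ffunE [RHS]ffunE perm_wordE (canF_eq (permK s)).
  rewrite perm_wordE nb; case: eqP => // si; case/eqP: ib.
  by apply: (@perm_inj _ s); rewrite permKV; apply/val_inj => /=; lia.
apply: eq_opp0; rewrite {1}(reindex_inj (mulIg (tperm a b))) -sumrN; apply: eq_bigr => s _.
rewrite -scaleNr; congr (_ *: << _ >>); last first.
  apply/ffunP => j; rewrite !ffunE permM; case: tpermP => [->|->|/eqP sa /eqP sb].
  - by rewrite eqxx (negPf ab) ma.
  - by rewrite (negPf ab) eqxx ma.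
  - by [].
by rewrite odd_permM odd_tperm ab addbT; case: (s : bool); rewrite ?expr0 ?expr1 ?opprK.
Qed.

Lemma alt_vec_coef : alt_vec@_(perm_word (1%g : 'S_k)) = 1.
Proof.
rewrite raddf_sum (bigD1 (1%g : 'S_k)) //= big1 => [|s s1].
  by rewrite odd_perm1 expr0 scale1r mcoeffUU addr0.
rewrite mcoeffZ mcoeffU; case: eqP => [/ffunP ws|_]; last by rewrite mulr0.
case/eqP: s1; apply/permP => i; rewrite perm1; apply/val_inj.
by have := ws i; rewrite !perm_wordE perm1 /=; lia.
Qed.
End TensorPower.

Lemma tensor_lift_ex (K : fieldType) (L : lieAlgType K) (V W : lieModType L)
    (U : lmodType K) (b : V -> W -> U) :
  (forall w, linear (b^~ w)) -> (forall v, linear (b v)) ->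
  exists2 T : tensor V W -> U, linear T & forall v w, T (tensor_pure v w) = b v w.
Proof.
move=> bl br.
have bal v c w : b (c *: v) w = b v (c *: w) by rewrite (linZ (bl w)) (linZ (br v)).
have bDl a v v' w := bl w a v v'; have bDr a v w w' := br v a w w'.
exists (tens_lift b); first exact: tens_lift_is_linear bDl bDr bal.
by move=> v w; apply: tens_lift_pure.
Qed.

Section HighestWeightVectors.
Context {K : numFieldType}.
Implicit Types (S : {pred int}) (V : lieModType (glinf K)).

(** The matrix units of gl_oo^(S,+) together with those of the positive part of gl_S. *)
Definition nilrel S m n := (n \notin S) || [&& m \in S, n \in S & m < n].

Definition hwvec S (f : int -> K) V (v : V) : Prop :=
  [/\ v <> 0, forall i, act (gE i i) v = f i *: v
    & forall m n, nilrel S m n -> act (gE m n) v = 0].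

(** The linear form l certifies that v is nonzero in a way that passes to tensor products: the
    product of two such forms takes the value 1 on v (x) w, whereas nonvanishing in a quotient space
    is not directly visible. *)
Definition hwmodel S (f : int -> nat) : Prop :=
  exists (V : lieModType (glinf K)) (d : nat) (v : V) (l : V -> K^o),
  [/\ polymod d V, linear l, l v = 1, forall i, act (gE i i) v = (f i)%:R *: v
    & forall m n, nilrel S m n -> act (gE m n) v = 0].

Lemma hwmodel_tpow (r n : int) k : r + k%:Z <= n + 1 ->
  hwmodel (zint r n) (fun i => r <= i < r + k%:Z)%R.
Proof.
move=> kn; exists (tpow k), k, (@alt_vec K k r).
exists (fun u : {malg K[_]} => u@_(perm_word r (1%g : 'S_k))).
split.
- exact: polymod_tpow.
- by move=> a u v; rewrite mcoeffD mcoeffZ.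
- exact: alt_vec_coef.
- exact: alt_vec_weight.
move=> p q; rewrite /nilrel /zint !inE => pq.
have [qr|qr] := boolP (r <= q < r + k%:Z); last exact: alt_vec_out.
have [pr pn] : r <= p < r + k%:Z /\ p != q by lia.
exact: alt_vec_in.
Qed.

Lemma hwmodel_tensor S f g : hwmodel S f -> hwmodel S g ->
  hwmodel S (fun i => f i + g i)%N.
Proof.
move=> [V [d [v [l [pV ll lv fv nv]]]]] [W [e [w [l' [pW ll' lw gw nw]]]]].
have [|v'|T T_lin TE] := @tensor_lift_ex _ _ V W _ (fun v w => l v * l' w : K^o).
- by move=> w' a x y; rewrite ll mulrDl /GRing.scale /= mulrA.
- by move=> a x y; rewrite ll' mulrDr /GRing.scale /= mulrCA.
exists (tensor V W), (d + e)%N, (tensor_pure v w), T; split=> //.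
- exact: polymod_tensor.
- by rewrite TE lv lw mulr1.
- by move=> i; rewrite act_pure fv gw pureZl pureZr -scalerDl natrD.
- by move=> m n mn; rewrite act_pure nv // nw // pure0l pure0r addr0.
Qed.

(* The set of i with f i > 0 is an initial segment of S, of length k say; by
   subtracting the fundamental weight of that segment one lowers f r. *)
Lemma hwmodel_dominant (r n : int) (f : int -> nat) : r <= n ->
  (forall i, i \notin zint r n -> f i = 0%N) ->
  (forall i j, i \in zint r n -> j \in zint r n -> i < j -> (f j <= f i)%N) ->
  hwmodel (zint r n) f.
Proof.
move=> rn; have [m] := ubnP (f r); elim: m f => // m IH f fm f0 f_dec.
have [k kn kf] : exists2 k : nat, (r + k%:Z <= n + 1)%R &
    forall i, (0 < f i)%N = (r <= i < r + k%:Z)%R.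
  (* The position n + 1 lies outside of S, so that f has a zero to the right of r; k is the distance
     from r to the first zero. *)
  have fn : f (r + (absz (n + 1 - r)%R)%:Z)%R == 0%N by rewrite f0 // /zint !inE; lia.
  case: (ex_minnP (ex_intro (fun k : nat => f (r + k%:Z)%R == 0%N) _ fn)).
  move=> k /eqP fk k_min; have := k_min _ fn => kn.
  exists k => [|i]; first by lia.
  apply/idP/idP => [fi|ik].
    have : i \in zint r n by apply: contraTT fi => /f0 ->.
    rewrite /zint inE => inz; case/andP: (inz) => ri _; rewrite ri /=.
    rewrite ltNge; apply/negP; rewrite le_eqVlt => /predU1P[ki|ki].
      by rewrite -ki fk in fi.
    have := f_dec (r + k%:Z) i; rewrite /zint !inE fk => /(_ _ inz ki).
    by rewrite leqn0 -(negbK (_ == _)) -lt0n fi => /(_ ltac:(lia)).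
  rewrite lt0n; apply/negP => fi.
  have /k_min : f (r + (absz (i - r)%R)%:Z)%R == 0%N by rewrite [_ + _](_ : _ = i) //; lia.
  by lia.
have fE : f = (fun i => nat_of_bool (r <= i < r + k%:Z)%R + (f i).-1)%N.
  by apply: funext => i; rewrite -kf; case: (f i).
(* For k = 0 the value f r is already zero and cannot decrease; then f = 0, realised by the zeroth
   tensor power. *)
have [k0|k_gt0] := posnP k.
  suff -> : f = (fun i => nat_of_bool (r <= i < r + k%:Z)%R) by apply: hwmodel_tpow.
  apply: funext => i; have := kf i; rewrite k0 [(_ <= _ < _)%R](_ : _ = false); last by lia.
  by case: (f i).
rewrite fE; apply: hwmodel_tensor; first exact: hwmodel_tpow.
apply: IH => [|i /f0 -> //|i j iS jS ij].
  by have := kf r; lia.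
by have := f_dec i j iS jS ij; lia.
Qed.
End HighestWeightVectors.

(** * Irreducible modules *)

(* The elements of X of degree c are the multiples of (p, q), as the elements of
   A lower the degree. *)
Lemma hw_graph (K : numFieldType) (L : lieAlgType K) (A B : L -> Prop) (D : L) (c : K)
    (P Q : lieModType L) (p : P) (q : Q) :
  (forall x, span (fun y => A y \/ B y) x) ->
  (forall a, A a -> exists j : nat, bracket D a = - (j.+1%:R) *: a) ->
  (forall b, B b -> exists x, act b p = x *: p /\ act b q = x *: q) ->
  act D p = c *: p -> act D q = c *: q -> p <> 0 -> q <> 0 ->
  let X := closure A (line ((p, q) : prodm P Q)) in
  [/\ submodule X, X (p, q), ~ X (p, 0) & ~ X (0, q)].
Proof.
move=> AB AD Bpq Dp Dq p0 q0 X.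
have DN0 v : line ((p, q) : prodm P Q) v -> act D v = c *: v.
  move=> [a ->]; rewrite linearZ_LR /= scalerA [c * a]mulrC -scalerA; congr (_ *: _).
  by rewrite -[act D _]/(act D p, act D q) Dp Dq.
have Xcoef v : act D v = c *: v -> X v -> exists a, v = a *: ((p, q) : prodm P Q).
  move=> Dv /(closure_low AD DN0)[_ [a ->]] lv; exists a; apply/eqP.
  rewrite -subr_eq0; apply/eqP; apply: low_eig0 lv.
  by rewrite linearB /= Dv (DN0 (a *: (p, q))) ?scalerBr //; exists a.
have Dpair u v : act D u = c *: u -> act D v = c *: v ->
    act D ((u, v) : prodm P Q) = c *: ((u, v) : prodm P Q).
  by move=> Du Dv; rewrite -[act D _]/(act D u, act D v) Du Dv.
split.
- apply: (closure_submodule (B := B)) => // b v Bb [a ->].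
  have [x [bp bq]] := Bpq b Bb; exists (a * x).
  rewrite linearZ_LR /= -scalerA; congr (_ *: _).
  by rewrite -[act b _]/(act b p, act b q) bp bq.
- by apply: sub_closure; exists 1; rewrite scale1r.
- move=> /Xcoef[|a]; first by apply: Dpair; rewrite // linear0 scaler0.
  move=> [pE /esym/eqP]; rewrite scaler_eq0 => /orP[/eqP a0|/eqP//].
  by apply: p0; rewrite pE a0 scale0r.
move=> /Xcoef[|a]; first by apply: Dpair; rewrite // linear0 scaler0.
move=> [/esym/eqP]; rewrite scaler_eq0 => /orP[/eqP a0|/eqP//] qE.
by apply: q0; rewrite qE a0 scale0r.
Qed.

Section Triangular.
Context {K : numFieldType}.
Implicit Types (S : {pred int}) (c : int -> nat) (l : seq int).

Definition lowE c (x : glinf K) : Prop := exists p q, x = gE p q /\ (c p < c q)%N.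
Definition highE c (x : glinf K) : Prop := exists p q, x = gE p q /\ (c q <= c p)%N.

Lemma span_lowE_highE c x : span (fun y => lowE c y \/ highE c y) x.
Proof.
elim/(@gl_ind K): x => [|a u v|p q]; first exact: subspace0.
  exact: subspaceP.
apply: sub_span; have [qp|pq] := leqP (c q) (c p); last by left; exists p, q.
by right; exists p, q.
Qed.

Lemma lowE_degree c l a : uniq l -> (forall i, i \notin l -> c i = 0%N) ->
  lowE c a -> exists j : nat, bracket (degE c l) a = - (j.+1%:R) *: a.
Proof.
move=> ul c0 [p [q [-> pq]]]; have [j jE] := @degE_lower K c p q pq; exists j.
exact: etrans (degE_bracket p q ul c0) (congr1 (fun a : K => a *: gE p q) jE).
Qed.

Lemma gl_closure_submodule c (V : lieModType (glinf K)) (N0 : subspace V) :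
  (forall p q u, (c q <= c p)%N -> N0 u -> N0 (act (gE p q) u)) ->
  submodule (closure (lowE c) N0).
Proof.
move=> cN0; apply: (closure_submodule (B := highE c)); first exact: span_lowE_highE.
by move=> _ u [p [q [-> qp]]]; apply: cN0.
Qed.

Definition lowS S c (x : @glS K S) : Prop := exists p q,
  [/\ x = unitS S p q, p \in S, q \in S & (c p < c q)%N].
Definition highS S c (x : @glS K S) : Prop := exists p q,
  [/\ x = unitS S p q, p \in S, q \in S & (c q <= c p)%N].

Lemma span_lowS_highS S c (x : @glS K S) : span (fun y => lowS c y \/ highS c y) x.
Proof.
elim/(@glS_ind K S): x => [|a u v|p q pS qS]; first exact: subspace0.
  exact: subspaceP.
apply: sub_span; have [qp|pq] := leqP (c q) (c p); last by left; exists p, q.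
by right; exists p, q.
Qed.

Lemma lowS_degree S c l (a : @glS K S) : uniq l -> {subset l <= S} ->
  (forall i, i \notin l -> c i = 0%N) ->
  lowS c a -> exists j : nat, bracket (degS S c l) a = - (j.+1%:R) *: a.
Proof.
move=> ul lS c0 [p [q [-> pS qS pq]]].
have [|j jE] := @lowE_degree c l (gE p q) ul c0; first by exists p, q.
exists j; apply/val_inj.
rewrite -[LHS]/(bracket (lsval (degS S c l)) (lsval (unitS S p q))).
rewrite -[RHS]/(- (j.+1%:R) *: lsval (unitS S p q)).
apply: etrans (congr2 bracket (val_degS c lS) (val_unitS pS qS)) _.
exact: etrans jE (congr1 ( *:%R _) (esym (val_unitS pS qS))).
Qed.

(** Chosen so that the units E_{p,q} with rank q <= rank p are exactly the diagonal ones and those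
    of [nilrel]. The summand 1 keeps the rank positive on S, so that E_{p,q} with q in S and p
    outside lowers strictly. *)
Definition rank (r n i : int) : nat := if r <= i <= n then absz (n + 1 - i)%R else 0%N.

Definition interval (r n : int) : seq int :=
  [seq r + i%:Z | i <- iota 0 (absz (n + 1 - r)%R)].

Lemma interval_uniq r n : uniq (interval r n).
Proof. by rewrite map_inj_uniq ?iota_uniq // => i j; lia. Qed.

Lemma mem_interval r n : r <= n -> interval r n =i zint r n.
Proof.
move=> rn i; rewrite /zint inE; apply/mapP/idP => [[j]|ri].
  by rewrite mem_iota => ? ->; lia.
by exists (absz (i - r)); rewrite ?mem_iota; lia.
Qed.

Lemma rank_out r n i : r <= n -> i \notin interval r n -> rank r n i = 0%N.
Proof. by move=> rn; rewrite mem_interval // /zint inE /rank => /negPf ->. Qed.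

Lemma rank_le r n p q : (rank r n q <= rank r n p)%N ->
  [\/ q \notin zint r n, [/\ p \in zint r n, q \in zint r n & p < q] | p = q].
Proof.
rewrite /zint !inE /rank; case: ifP => qS; last by constructor 1.
case: ifP => pS; last by lia.
move=> pq; have [->|ne] := eqVneq p q; first by constructor 3.
by constructor 2; split=> //; lia.
Qed.

(** For this grading the lowering units are the E_{p,q} with p outside S and q in S, and the others
    span gl_oo^(S,+) + gl_S. *)
Definition ind (S : {pred int}) (i : int) : nat := i \in S.

Lemma ind_le S p q : (ind S q <= ind S p)%N -> q \notin S \/ p \in S /\ q \in S.
Proof. by rewrite /ind; do 2 case: (_ \in S); auto. Qed.
End Triangular.

Section IrreducibleModules.
Context {K : numFieldType} (r n : int) (rn : r <= n).
Local Notation S := (zint r n).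
Local Notation l := (interval r n).
Local Notation rk := (rank r n).

Let lS : {subset l <= S}. Proof. by move=> i; rewrite mem_interval. Qed.

Lemma hwvec_rank (f : int -> K) (V : lieModType (glinf K)) (v : V) p q :
  hwvec S f v -> (rk q <= rk p)%N ->
  act (gE p q) v = (if p == q then f p else 0) *: v.
Proof.
move=> [v0 fv nv] /rank_le[qS|[pS qS pq]|->]; last by rewrite eqxx.
  case: eqP => [->//|_]; by rewrite nv ?scale0r // /nilrel qS.
by rewrite lt_eqF // scale0r nv // /nilrel pS qS pq orbT.
Qed.

Lemma irreducible_submodule_full (V : lieModType (glinf K)) (v : V) (N : subspace V) :
  irreducible_module V -> submodule N -> N v -> v <> 0 -> forall w, N w.
Proof. by move=> [_ irrV] /irrV[] // N0 /N0. Qed.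

(** The submodule X of V * P generated by (v, p) has zero left kernel, as V is irreducible, and full
    left image. P may be reducible, so X need not be the graph of an embedding of V: it exhibits V
    as a quotient of the submodule of P generated by p, which is enough to compare weights. The
    degree d comes from P and serves all V. *)
Lemma irreducible_polymod (f : int -> nat) : @hwmodel K S f ->
  exists d, forall (V : lieModType (glinf K)) (v : V),
  irreducible_module V -> hwvec S (fun i => (f i)%:R) v -> polymod d V.
Proof.
move=> [P [d [p [ell [polyP ell_lin ell1 fp np]]]]]; exists d => V v irrV hv.
have p0 : p <> 0.
  by move=> p0; move: ell1; rewrite p0 (lin0 ell_lin) => /esym/eqP; rewrite oner_eq0.
have hp : hwvec S (fun i => (f i)%:R) p by split.
have [v0 fv nv] := hv.
pose D : glinf K := degE rk l; pose c := \sum_(i <- l) (rk i)%:R * (f i)%:R : K.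
have [] := @hw_graph K (glinf K) (lowE rk) (highE rk) D c V P v p
  (@span_lowE_highE K rk) _ _ _ _ v0 p0.
- by move=> a; apply: lowE_degree; [apply: interval_uniq | move=> i; apply: rank_out].
- move=> _ [x [y [-> yx]]]; exists (if x == y then (f x)%:R else 0).
  by rewrite (hwvec_rank hv) // (hwvec_rank hp).
- by apply: degE_act.
- by apply: degE_act.
set X := closure _ _ => subX Xvp Xv0 _.
have kerX u : X (u, 0) -> u = 0.
  have [_ /(_ (left_ker X) (left_ker_sub subX))[h /h //|Vker]] := irrV.
  by case: Xv0; apply: Vker.
pose Y := fun u : V => exists2 s, size s = d & wt s u.
suff XY : forall x, X x -> span Y x.1.
  move=> u; have [|w /XY //] := irreducible_submodule_full irrV (left_im_sub subX) _ v0 u.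
  by exists p.
(* X is generated by a weight vector, hence spanned by weight vectors. The second coordinate of a
   nonzero one is nonzero, so that its weight is a weight of P. *)
pose T := fun x : prodm V P => X x /\ exists f : int -> K, forall i, act (gE i i) x = f i *: x.
suff XT : forall x, X x -> span T x.
  move=> x /XT; move: x; apply: span_ind => [|a x y Yx Yy|[u w] [Xuw [g gx]]].
  - exact: subspace0.
  - exact: subspaceP.
  have gu i : act (gE i i) u = g i *: u := congr1 fst (gx i).
  have gw i : act (gE i i) w = g i *: w := congr1 snd (gx i).
  have [w0|/eqP w0] := eqVneq w 0.
    rewrite -[(u, w).1]/u (kerX u); first exact: subspace0.
    by rewrite -w0.
  have [s sd sE] := weight_is_wt polyP w0 gw.
  by apply: sub_span; exists s => // i; rewrite gu sE.
apply: closure_ind => [|a x y|x [a ->]|_ x [p' [q' [-> pq]]]].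
- exact: subspace0.
- exact: subspaceP.
- apply/subspaceZ/sub_span; split=> //; exists (fun i => (f i)%:R) => i.
  by rewrite -[act _ _]/(act (gE i i) v, act (gE i i) p) fv fp.
apply: (@span_linear _ _ _ (act (gE p' q'))) => y [Xy [g gy]].
apply: sub_span; split; first exact: subX.
by eexists; apply: weight_gE gy.
Qed.

(** The vector is the image of 1 (x) u under the quotient map, u being the highest weight vector of
    U. The condition on the support is what makes E_{i,i} with i outside S, which acts by zero, have
    the eigenvalue lambda prescribes. *)
Lemma is_L_hwvec (lambda : weight K) (V : lieModType (glinf K)) :
  {subset supp lambda <= S} -> is_L S lambda V ->
  irreducible_module V /\ exists v : V, hwvec S (weight_at lambda) v.
Proof.
move=> suppS [U [[irrU [u [u0 nu fu genu]]] [irrV [f [[f_lin f_act] f_surj]]]]].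
split=> //; pose g (x : U) : V := f (induced_pure 1 (x : inflate U)).
have g_lin : linear g.
  move=> a x y; rewrite /g -f_lin; congr f; exact: induced_pureDr.
have g_act (x : glPar S) (y : U) : act (lsval x) (g y) = g (act (corner x) y).
  rewrite /g -f_act; congr f.
  rewrite -[act _ _]/(induced_act (lsval x) _) induced_act_pure.
  rewrite mulr1 -env_incl_in -[X in induced_pure X]mul1r induced_pure_bal env_act_in.
  by [].
have g_out p q y : q \notin S -> act (gE p q) (g y) = 0.
  move=> qS; have pq : relPar S p q by rewrite /relPar /relSplus qS.
  pose x : glPar S := @LieSubEl K _ (glPar S) _ (glspan_E pq).
  rewrite -[gE p q]/(lsval x) g_act (_ : corner x = 0) ?act0l ?(lin0 g_lin) //.
  by apply/val_inj; rewrite /= corner_funE /relS (negPf qS) andbF.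
have g_in p q y : p \in S -> q \in S -> act (gE p q) (g y) = g (act (unitS S p q) y).
  move=> pS qS; have pq : relPar S p q by rewrite /relPar /relS pS qS orbT.
  pose x : glPar S := @LieSubEl K _ (glPar S) _ (glspan_E pq).
  by rewrite -[gE p q]/(lsval x) g_act; congr (g (act _ _)); apply/val_inj.
(* The kernel of g is a gl_S-submodule. If it contained u, it would be all of U; since 1 (x) U
   generates the induced module, its irreducible quotient V would vanish. *)
have g0 : g u <> 0.
  move=> gu; have [[v v0] _] := irrV; apply: v0.
  pose N0 := fun x => g x = 0.
  have N00 : N0 0 by apply: lin0 g_lin.
  have N0P a x y : N0 x -> N0 y -> N0 (a *: x + y).
    by rewrite /N0 g_lin => -> ->; rewrite scaler0 addr0.
  have N0act (x : glS S) y : N0 y -> N0 (act x y).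
    move=> gy; elim/(@glS_ind K S): x => [|a x x' h h'|p q pS qS].
    - by rewrite act0l.
    - by rewrite actDl; apply: (N0P a).
    - by rewrite /N0 -g_in // gy linear0.
  have gall : forall x, g x = 0 := genu (Subspace N00 N0P) N0act gu.
  have [m <-] := f_surj v.
  elim/(@induced_ind K (glinf K) (glPar S) (inflate U)): m => [|a m m' h h'|x y].
  - exact: lin0 f_lin.
  - by rewrite f_lin h h' scaler0 addr0.
  elim/(@env_ind K (glinf K)): x => [|a x x' h h'|x x' h].
  - exact: gall.
  - by rewrite induced_pureDl f_lin h h' scaler0 addr0.
  rewrite -induced_act_pure -[induced_act x _]/(act x _) f_act h linear0. by [].
exists (g u); split=> // [i|p q].
  have [iS|iS] := boolP (i \in S).
    rewrite g_in // (fu (unitS S i i) (hE i)) ?(linZ g_lin) //.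
    by rewrite val_unitS.
  rewrite g_out //; have : i \notin supp lambda by apply: contra iS => /suppS.
  by rewrite inE negbK => /eqP ->; rewrite scale0r.
rewrite /nilrel => /orP[qS|/and3P[pS qS pq]]; first exact: g_out.
rewrite g_in // nu ?(lin0 g_lin) // val_unitS //.
exact: glspan_E.
Qed.
End IrreducibleModules.

(** * Truncation to gl_S *)

Section Embeddings.
Context {K : numFieldType} {r n : int} (rn : r <= n).
Local Notation S := (zint r n).
Local Notation l := (interval r n).
Local Notation D := (degE (ind S) l : glinf K).
Local Notation DS := (degS S (ind S) l : @glS K S).
Implicit Types (A B : lieModType (@glS K S)) (V W : lieModType (glinf K)).

(* io identifies A with a gl_S-submodule of V which is killed by gl_oo^(S,+)
   and on which the sum of the E_{i,i} with i in S acts by c. *)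
Definition embeds (c : K) A V (io : A -> V) : Prop :=
  [/\ linear io, forall x a, io (act x a) = act (lsval x) (io a),
      forall a, io a = 0 -> a = 0,
      forall p q a, q \notin S -> act (gE p q) (io a) = 0
    & forall a, act D (io a) = c *: io a].

Definition graded (c : K) A V (io : A -> V) : Prop :=
  forall v, exists a, low D c (v - io a).

(** The image of A generates V and meets every nonzero submodule of V. This is the substitute for
    irreducibility that also makes sense for tensor products and direct sums. *)
Definition tight A V (io : A -> V) : Prop :=
  (forall N : subspace V, submodule N -> (forall a, N (io a)) -> forall v, N v) /\
  (forall N : subspace V, submodule N -> (forall a, N (io a) -> a = 0) ->
     forall v, N v -> v = 0).

Let lS : {subset l <= S}. Proof. by move=> i; rewrite mem_interval. Qed.

Lemma ind_out i : i \notin l -> ind S i = 0%N.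
Proof. by rewrite mem_interval // /ind => /negPf ->. Qed.

Lemma act_DS c A V (io : A -> V) (a : A) : embeds c io -> act DS a = c *: a.
Proof.
move=> [io_lin io_act io_inj _ ioD]; apply/eqP; rewrite -subr_eq0; apply/eqP/io_inj.
rewrite (linB io_lin) (linZ io_lin) (io_act DS a) -ioD.
have E : lsval DS = D := val_degS (ind S) lS.
by rewrite E subrr.
Qed.

Lemma gl_closure_low c V (N0 : subspace V) v :
  (forall u, N0 u -> act D u = c *: u) -> closure (lowE (ind S)) N0 v ->
  exists2 v0, N0 v0 & low D c (v - v0).
Proof.
move=> DN0; apply: (closure_low _ DN0) => a.
by apply: lowE_degree; [apply: interval_uniq | apply: ind_out].
Qed.

Lemma restr_actE V p q (v : V) : p \in S -> q \in S ->
  act (unitS S p q) (v : restr V) = act (gE p q) v.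
Proof.
by move=> pS qS; rewrite -[LHS]/(act (lsval (unitS S p q)) v) val_unitS.
Qed.

Lemma parabolic_submodule V (N0 : subspace V) :
  (forall p q u, q \notin S -> N0 u -> act (gE p q) u = 0) ->
  (forall p q u, p \in S -> q \in S -> N0 u -> N0 (act (gE p q) u)) ->
  submodule (closure (lowE (ind S)) N0).
Proof.
move=> N0out N0in; apply: gl_closure_submodule => p q u /ind_le[qS|[pS qS]] Nu.
  by rewrite N0out //; apply: subspace0.
exact: N0in.
Qed.

Section Existence.
Context (f : int -> K) (A : lieModType (@glS K S)) (V : lieModType (glinf K)).
Context (a0 : A) (v : V).
Hypothesis irrA : irreducible_module A.
Hypothesis irrV : irreducible_module V.
Hypothesis hv : hwvec S f v.
Hypothesis a0_neq0 : a0 <> 0.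
Hypothesis fa0 : forall i, i \in S -> act (unitS S i i) a0 = f i *: a0.
Hypothesis na0 : forall p q, p \in S -> q \in S -> p < q -> act (unitS S p q) a0 = 0.

(** The gl_S-submodule of A * V generated by the two highest weight vectors is a graph.
    Irreducibility of A gives the zero left kernel and the full left image; the right kernel needs
    irreducibility of V over gl_oo. *)
Lemma embeds_exists : exists (c : K) (io : A -> V), embeds c io.
Proof.
have [v0 fv nv] := hv; pose rk := rank r n.
pose c := \sum_(i <- l) (ind S i)%:R * f i : K; exists c.
pose d := \sum_(i <- l) (rk i)%:R * f i : K.
pose RV : lieModType (@glS K S) := restr V.
have degS_act (M : lieModType (@glS K S)) (m : M) :
    (forall i, i \in S -> act (unitS S i i) m = f i *: m) ->
    act (degS S rk l) m = d *: m.
  move=> fm; rewrite degSE.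
  rewrite act_suml scaler_suml big_seq [RHS]big_seq; apply: eq_bigr => i /lS iS.
  by rewrite actZl fm // scalerA.
have [] := @hw_graph K (@glS K S) (lowS rk) (highS rk) (degS S rk l) d A RV a0 v
  (@span_lowS_highS K S rk) _ _ _ _ a0_neq0 v0.
- by move=> a; apply: lowS_degree; [apply: interval_uniq | | move=> i; apply: rank_out].
- move=> _ [p [q [-> pS qS pq]]]; exists (if p == q then f p else 0).
  rewrite restr_actE // (hwvec_rank hv) //; split=> //.
  case: (rank_le pq) => [|[_ _ lt]|->]; first by rewrite qS.
    by rewrite lt_eqF // scale0r na0.
  by rewrite eqxx fa0.
- exact: degS_act.
- by apply: degS_act => i iS; rewrite restr_actE ?fv.
set X := closure _ _ => subX Xav Xa0 X0v.
(* Both properties hold at v and are inherited under gl_S, which normalizes gl_oo^(S,+) and commutes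
   with [D]. *)
have X2 x : X x -> (forall p q, q \notin S -> act (gE p q) (x.2 : V) = 0) /\
    act D (x.2 : V) = c *: (x.2 : V).
  pose T := fun x : prodm A RV => (forall p q, q \notin S -> act (gE p q) (x.2 : V) = 0) /\
    act D (x.2 : V) = c *: (x.2 : V).
  rewrite -/(T x); move: x; apply: closure_ind => [|a x y [xo xD] [yo yD]|x [a ->]|].
  - by split=> [p q _|]; rewrite -[(0 : prodm A RV).2]/(0 : V) linear0 ?scaler0.
  - split=> [p q qS|]; first by rewrite actDr xo // yo // scaler0 addr0.
    by rewrite [LHS]actDr xD yD scalerDr !scalerA [a * c]mulrC.
  - split=> [p q qS|]; first by rewrite [LHS]linearZ_LR /= nv ?scaler0 // /nilrel qS.
    rewrite [LHS]linearZ_LR /= [X in _ *: X](@degE_act K V _ _ f) //.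
    by rewrite !scalerA mulrC.
  move=> _ x [p [q [-> pS qS pq]]] [xo xD].
  have E : (act (unitS S p q) x).2 = act (gE p q) (x.2 : V) :> V by apply: restr_actE.
  rewrite /T E.
  split=> [p' q' q'S|].
    rewrite act_gE_comm xo // linear0 add0r [act (gE p q') _]xo //.
    have -> : (q' == p) = false by apply: contraNF q'S => /eqP ->.
    by rewrite sub0r; case: ifP; rewrite oppr0.
  rewrite act_comm xD linearZ_LR degE_bracket; first last.
  - exact: ind_out.
  - exact: interval_uniq.
  by rewrite /ind pS qS subrr scale0r act0l addr0.
(* The right kernel Y lies in degree c. If it is nonzero, V is obtained from Y by lowering units
   alone, so that Y is the whole of degree c and contains v, against [X0v]. *)
have Xr0 y : X (0, y) -> y = 0.
  move=> Xy; apply: contrapT => y0; apply: X0v.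
  pose Y : subspace V := right_ker X.
  have YX u : Y u -> X (0, u) by [].
  have subC : submodule (closure (lowE (ind S)) Y).
    apply: parabolic_submodule => [p q u qS /YX/X2[uo _]|p q u pS qS Yu]; first exact: uo.
    have := right_ker_sub subX (unitS S p q) Yu.
    by rewrite [X in right_ker _ X](@restr_actE V p q u).
  have Cy : closure (lowE (ind S)) Y y by apply: sub_closure.
  have := irreducible_submodule_full irrV subC Cy y0 v.
  case/(@gl_closure_low c) => [u /YX/X2[]//|u Yu lu].
  have Du : act D u = c *: u by have [] := X2 _ (YX _ Yu).
  suff -> : v = u by [].
  apply/eqP; rewrite -subr_eq0; apply/eqP; apply: low_eig0 lu.
  by rewrite linearB /= Du (@degE_act K V _ _ f) // scalerBr.
have Xl0 a : X (a, 0) -> a = 0.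
  have [_ /(_ (left_ker X) (left_ker_sub subX))[h /h //|Vker]] := irrA.
  by case: Xa0; apply: Vker.
have [|io [[io_lin io_act] ioX]] := graph_hom subX _ Xr0.
  move=> a; have [_ /(_ (left_im X) (left_im_sub subX))[h|//]] := irrA.
  by case: a0_neq0; apply: h; exists v.
have Xio a : X (a, io a) by apply/ioX.
exists io; split=> // [a ioa|p q a qS|a].
- by apply: Xl0; have := Xio a; rewrite [io a]ioa.
- by have [+ _] := X2 _ (Xio a); apply.
- by have [] := X2 _ (Xio a).
Qed.
End Existence.

Lemma generated_graded c A V (io : A -> V) :
  embeds c io -> (forall N : subspace V, submodule N -> (forall a, N (io a)) -> forall v, N v) ->
  graded c io.
Proof.
move=> [io_lin io_act io_inj ioo ioD] gen v.
have subC : submodule (closure (lowE (ind S)) (im_sub io_lin)).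
  apply: parabolic_submodule => [p q _ qS [a ->]|p q _ pS qS [a ->]]; first exact: ioo.
  by exists (act (unitS S p q) a); rewrite io_act val_unitS.
have Cio a : closure (lowE (ind S)) (im_sub io_lin) (io a).
  by apply: sub_closure; exists a.
have /(@gl_closure_low c)[|_ [a ->] lv] := gen _ subC Cio v.
  by move=> _ [a ->]; apply: ioD.
by exists a.
Qed.

Lemma irreducible_tight c A V (io : A -> V) (a : A) :
  embeds c io -> irreducible_module V -> a <> 0 -> tight io.
Proof.
move=> [io_lin io_act io_inj ioo ioD] [_ irrV] a0; split=> N subN Nio v.
  by have [N0|//] := irrV N subN; case: a0; apply/io_inj/N0.
by have [/(_ v)//|Nall] := irrV N subN; case: a0; apply: Nio.
Qed.

Lemma graded_uniq c A V (io : A -> V) v a a' : embeds c io ->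
  low D c (v - io a) -> low D c (v - io a') -> a = a'.
Proof.
move=> [io_lin io_act io_inj ioo ioD] la la'; apply/eqP; rewrite -subr_eq0.
apply/eqP/io_inj; apply: (@low_eig0 _ _ _ D c); first exact: ioD.
have := subspaceB la' la; rewrite opprB addrC addrA subrK (linB io_lin).
by [].
Qed.

(** Projection to degree c. It is only linear, which suffices for its purpose: tensoring two such
    retractions shows that the tensor product of two embeddings is injective. *)
Lemma graded_retraction c A V (io : A -> V) : embeds c io -> graded c io ->
  exists2 rho : V -> A, linear rho & forall a, rho (io a) = a.
Proof.
move=> emb gr; have [io_lin io_act io_inj ioo ioD] := emb.
pose rho v := projT1 (cid (gr v)).
have rhoP v : low D c (v - io (rho v)) by rewrite /rho; case: (cid _).
exists rho => [a u v|a]; last first.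
  by apply: (graded_uniq emb (rhoP _)); rewrite subrr; apply: subspace0.
apply: (graded_uniq emb (rhoP _)).
by rewrite io_lin opprD addrACA -scalerBr; apply: subspaceP; apply: rhoP.
Qed.

Lemma sum_count_mem (s : seq int) : all (mem S) s ->
  \sum_(i <- l) (ind S i)%:R * (count_mem i s)%:R = (size s)%:R :> K.
Proof.
move=> sS; transitivity ((\sum_(i <- l) count_mem i s)%:R : K).
  rewrite natr_sum big_seq [RHS]big_seq; apply: eq_bigr => i /lS iS.
  by rewrite /ind iS mul1r.
congr _%:R; elim: s sS => [|x s IH] /=; first by rewrite big1.
move=> /andP[xS sS]; rewrite big_split /= IH // -add1n; congr (_ + _)%N.
transitivity (count_mem x l).
  by rewrite -sum1_count [RHS]big_mkcond; apply: eq_bigr => i _ /=; rewrite eq_sym; case: eqP.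
by rewrite count_uniq_mem ?interval_uniq // mem_interval // xS.
Qed.

Lemma wt_degree V (s : seq int) (x : V) : wt s x -> all (mem S) s ->
  act D x = (size s)%:R *: x.
Proof.
move=> sx sS; rewrite (@degE_act K V _ _ (fun i => (count_mem i s)%:R)) //.
by rewrite sum_count_mem.
Qed.

(** A weight vector in the image of io is killed by E_{i,i} for i outside S, so all d letters of its
    weight lie in S and are counted by [D]. *)
Lemma embeds_degree c d A V (io : A -> V) (a : A) : embeds c io -> polymod d V ->
  a <> 0 -> c = d%:R.
Proof.
move=> [io_lin io_act io_inj ioo ioD] polyV a0.
have [||_ [s [[b ->] b0 sd sx]]] :=
    @weight_vector_exists _ d V (im_sub io_lin) (io a) polyV _ _ (fun h => a0 (io_inj _ h)).
- move=> i _ [b ->]; have [iS|iS] := boolP (i \in S); last first.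
    by rewrite ioo //; apply: subspace0.
  by exists (act (unitS S i i) b); rewrite io_act val_unitS.
- by exists a.
have sS : all (mem S) s.
  apply/allP => i si; rewrite inE /=; apply: contrapT => /negP iS.
  have := ioo i i b iS; rewrite sx => /eqP.
  rewrite scaler_eq0 pnatr_eq0 => /orP[/eqP/count_memPn|/eqP//]; by rewrite si.
have := wt_degree sx sS; rewrite ioD sd => /eqP.
by rewrite -subr_eq0 -scalerBl scaler_eq0 subr_eq0 => /orP[/eqP//|/eqP].
Qed.

(** A vector whose weight has all its d letters in S is of top degree, hence in the image of io;
    such vectors can be reached by moves from any weight vector. *)
Lemma polymod_tight d A V (io : A -> V) : embeds d%:R io -> graded d%:R io ->
  polymod d V -> roomy S d -> tight io.
Proof.
move=> emb gr polyV roomS; have [io_lin io_act io_inj ioo ioD] := emb.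
have wt_io s x : wt s x -> size s = d -> all (mem S) s -> exists a, x = io a.
  move=> sx sd sS; have [a la] := gr x; exists a; apply/eqP; rewrite -subr_eq0.
  apply/eqP; apply: low_eig0 la.
  by rewrite linearB /= ioD (wt_degree sx sS) sd scalerBr.
split=> N subN Nio.
  apply: (move_generate polyV roomS subN) => s x sx sd sS.
  by have [a ->] := wt_io s x sx sd sS.
move=> v Nv; apply: contrapT => v0.
have [|x [s [Nx x0 sd sx]]] := weight_vector_exists polyV _ Nv v0.
  by move=> i u; apply: subN.
have [y [t [Ny y0 td ty tS]]] := move_meet polyV roomS subN sx sd Nx x0.
have [a ya] := wt_io t y ty td tS.
by apply: y0; rewrite ya (Nio a) ?(lin0 io_lin) // -ya.
Qed.
End Embeddings.
Arguments embeds {K r n} c {A V} io.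
Arguments graded {K r n} c {A V} io.
Arguments tight {K r n A V} io.

Lemma tensor_linear_eq (K : fieldType) (L : lieAlgType K) (V W : lieModType L)
    (U : lmodType K) (F G : tensor V W -> U) : linear F -> linear G ->
  (forall v w, F (tensor_pure v w) = G (tensor_pure v w)) -> F =1 G.
Proof.
move=> F_lin G_lin FG; elim/(@tensor_ind _ _ V W) => [|a u v h h'|v w].
- by rewrite (lin0 F_lin) (lin0 G_lin).
- by rewrite F_lin G_lin h h'.
exact: FG.
Qed.

Section LinearMaps.
Context {K : fieldType} {U V W : lmodType K}.

Lemma linear_comp (f : V -> W) (g : U -> V) : linear f -> linear g -> linear (f \o g).
Proof. by move=> fl gl a u v; rewrite /= gl fl. Qed.
Lemma linear_scale (c : K) (f : U -> V) : linear f -> linear (fun u => c *: f u).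
Proof. by move=> fl a u v; rewrite fl scalerDr !scalerA mulrC. Qed.
Lemma linear_zero : linear (fun _ : U => 0 : V).
Proof. by move=> a u v; rewrite scaler0 addr0. Qed.
Lemma linear_id : linear (@id U). Proof. by []. Qed.
End LinearMaps.

Section LowTensor.
Context {K : numFieldType} {L : lieAlgType K} {V W : lieModType L} (D : L) (c d : K).

Lemma low_pure_eig (v : V) (w : W) j k : act D v = (c - j%:R) *: v ->
  act D w = (d - k%:R) *: w -> (0 < j + k)%N ->
  low D (c + d) (tensor_pure v w : tensor V W).
Proof.
move=> Dv Dw jk; apply: sub_span; exists (j + k).-1; rewrite prednK //.
rewrite act_pure Dv Dw pureZl pureZr -scalerDl natrD opprD.
by rewrite addrACA.
Qed.

Lemma low_pure_l (v : V) (w w0 : W) : low D c v -> act D w0 = d *: w0 ->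
  low D d (w - w0) -> low D (c + d) (tensor_pure v w : tensor V W).
Proof.
move=> lv Dw0 lw; move: v lv; apply: span_ind => [|a v v' h h'|v [j Dv]].
- by rewrite pure0l; apply: subspace0.
- by rewrite tensor_pureDl; apply: subspaceP.
rewrite -(subrK w0 w) (linD (fun x => tensor_pureDr x v)); apply: subspaceD.
  move: (w - w0) lw; apply: span_ind => [|a u u' h h'|u [k Du]].
  - by rewrite pure0r; apply: subspace0.
  - by rewrite tensor_pureDr; apply: subspaceP.
  exact: low_pure_eig Dv Du _.
by apply: (low_pure_eig (k := 0)) Dv _ _; rewrite // subr0.
Qed.

Lemma low_pure_r (v : V) (w : W) : act D v = c *: v ->
  low D d w -> low D (c + d) (tensor_pure v w : tensor V W).
Proof.
move=> Dv; move: w; apply: span_ind => [|a u u' h h'|u [k Du]].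
- by rewrite pure0r; apply: subspace0.
- by rewrite tensor_pureDr; apply: subspaceP.
by apply: (low_pure_eig (j := 0)) _ Du _; rewrite // subr0.
Qed.
End LowTensor.

Section EmbeddingConstructions.
Context {K : numFieldType} {r n : int} (rn : r <= n).
Local Notation S := (zint r n).
Local Notation l := (interval r n).
Local Notation D := (degE (ind S) l : glinf K).
Implicit Types (A B : lieModType (@glS K S)) (V W : lieModType (glinf K)).

(* The submodule of V * W generated by the graph of phi is itself a graph: its
   part of maximal degree is the graph of phi, and by tightness both of its
   kernels vanish. *)
Lemma embeds_iso c A B V W (io : A -> V) (io' : B -> W) :
  embeds c io -> embeds c io' -> tight io -> tight io' -> lie_iso A B -> lie_iso V W.
Proof.
move=> [io_lin io_act io_inj ioo ioD] [io'_lin io'_act io'_inj io'o io'D].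
move=> [gen meet] [gen' meet'] [phi [[phi_lin phi_act] [psi phiK psiK]]].
pose g a : prodm V W := (io a, io' (phi a)).
have g_lin : linear g.
  by move=> a u v; rewrite /g phi_lin io_lin io'_lin.
have gD a : act D (g a) = c *: g a.
  by rewrite -[act D _]/(act D (io a), act D (io' (phi a))) ioD io'D.
pose X := closure (lowE (ind S)) (im_sub g_lin).
have subX : submodule X.
  apply: parabolic_submodule => [p q _ qS [a ->]|p q _ pS qS [a ->]].
    by rewrite -[act _ _]/(act (gE p q) (io a), act (gE p q) (io' (phi a))) ioo // io'o.
  exists (act (unitS S p q) a); rewrite /g phi_act io_act io'_act.
  by rewrite val_unitS.
have Xg a : X (g a) by apply: sub_closure; exists a.
have XD x : X x -> exists a, low D c (x - g a).
  case/(@gl_closure_low _ _ _ rn c) => [_ [a ->]|_ [a ->] lx]; first exact: gD.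
  by exists a.
have Xeq x : act D x = c *: x -> X x -> exists a, x = g a.
  move=> Dx /XD[a la]; exists a; apply/eqP; rewrite -subr_eq0; apply/eqP.
  by apply: low_eig0 la; rewrite linearB /= Dx gD scalerBr.
have D0 (M : lieModType (glinf K)) : act D (0 : M) = c *: 0 by rewrite linear0 scaler0.
apply: (graph_iso subX).
- by apply: (gen _ (left_im_sub subX)) => a; exists (io' (phi a)); apply: Xg.
- apply: (gen' _ (right_im_sub subX)) => b; exists (io (psi b)).
  by have := Xg (psi b); rewrite /g psiK.
- apply: (meet _ (left_ker_sub subX)) => a /Xeq[|a' [ea ea']].
    exact: (congr2 pair (ioD a) (D0 W)).
  have /io'_inj pa' : io' (phi a') = 0 by [].
  have a'0 : a' = 0 by rewrite -[a']phiK pa' -(lin0 phi_lin) phiK.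
  by apply: io_inj; rewrite ea a'0 (lin0 io_lin).
apply: (meet' _ (right_ker_sub subX)) => b /Xeq[|a' [ea ea']].
  exact: (congr2 pair (D0 V) (io'D b)).
have /io_inj a'0 : io a' = 0 by [].
by apply: io'_inj; rewrite ea' a'0 (lin0 phi_lin) (lin0 io'_lin).
Qed.

(** Tightness is absent from the conclusion: tensor products do not inherit it in general, and it
    has to be recovered from room in S. *)
Lemma embeds_tensor c d A B V W (io : A -> V) (io' : B -> W) :
  embeds c io -> graded c io -> embeds d io' -> graded d io' ->
  exists2 io2 : tensor A B -> tensor V W, embeds (c + d) io2 & graded (c + d) io2.
Proof.
move=> emb gr emb' gr'.
have [rho rho_lin rhoK] := graded_retraction emb gr.
have [rho' rho'_lin rhoK'] := graded_retraction emb' gr'.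
have [io_lin io_act io_inj ioo ioD] := emb.
have [io'_lin io'_act io'_inj io'o io'D] := emb'.
have [|a|T T_lin TE] := @tensor_lift_ex _ _ A B (tensor V W)
    (fun a b => tensor_pure (io a) (io' b)).
- by move=> b x u v; rewrite io_lin tensor_pureDl.
- by move=> x u v; rewrite io'_lin tensor_pureDr.
have [|v|T' T'_lin T'E] := @tensor_lift_ex _ _ V W (tensor A B)
    (fun v w => tensor_pure (rho v) (rho' w)).
- by move=> w x u v; rewrite rho_lin tensor_pureDl.
- by move=> x u w; rewrite rho'_lin tensor_pureDr.
have TK u : T' (T u) = u.
  move: u; apply: tensor_linear_eq => [||a b].
  - exact: linear_comp T'_lin T_lin.
  - exact: linear_id.
  by rewrite /= TE T'E rhoK rhoK'.
have act_lin (M : lieModType (glinf K)) (x : glinf K) : linear (act x : M -> M).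
  by move=> a u v; apply: actDr.
exists T.
  split=> //.
  - move=> x; apply: tensor_linear_eq => [||a b].
    + by apply: linear_comp T_lin _ => a u v; apply: actDr.
    + exact: linear_comp (act_lin _ (lsval x)) T_lin.
    rewrite TE !act_pure -io_act -io'_act (linD T_lin).
    by rewrite !TE.
  - by move=> u Tu; rewrite -[u]TK Tu (lin0 T'_lin).
  - move=> p q u qS; move: u; apply: tensor_linear_eq => [||a b].
    + exact: linear_comp (act_lin _ _) T_lin.
    + exact: linear_zero.
    by rewrite TE act_pure ioo // io'o // pure0l pure0r addr0.
  apply: tensor_linear_eq => [||a b].
  - exact: linear_comp (act_lin _ _) T_lin.
  - exact: linear_scale T_lin.
  by rewrite TE act_pure ioD io'D pureZl pureZr -scalerDl.
move=> u; elim/(@tensor_ind _ _ V W): u => [|a u v [u' lu] [v' lv]|v w].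
- by exists 0; rewrite (lin0 T_lin) subr0; apply: subspace0.
- exists (a *: u' + v'); rewrite T_lin opprD addrACA -scalerBr.
  exact: subspaceP.
have [v' lv] := gr v; have [w' lw] := gr' w.
exists (tensor_pure v' w'); rewrite TE.
have -> : tensor_pure v w - tensor_pure (io v') (io' w') =
    tensor_pure (v - io v') w + tensor_pure (io v') (w - io' w') :> tensor V W.
  rewrite (linB (fun x u u' => tensor_pureDl x u u' w)).
  by rewrite (linB (fun x => tensor_pureDr x (io v'))) addrA subrK.
apply: subspaceD; last exact: low_pure_r.
by apply: (low_pure_l (w0 := io' w')).
Qed.
End EmbeddingConstructions.

Section DirectSumTheory.
Context {K : fieldType} {L : lieAlgType K} {I : Type} (V : I -> lieModType L).

Definition single_fun i (x : V i) j : V j :=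
  if pselect (i = j) is left e then ecast j (V j) e x else 0.

Fact single_fin i (x : V i) : finite_set (fun j => single_fun x j <> 0).
Proof.
apply: sub_finite_set (finite_set1 i) => j; rewrite /single_fun.
by case: pselect => //= ->.
Qed.
Definition single i (x : V i) : dsum V := Dsum (single_fin x).

Lemma singleE i (x : V i) : single x i = x.
Proof.
rewrite /= /single_fun; case: pselect => // e.
by rewrite (Prop_irrelevance e erefl).
Qed.

Lemma singleN i (x : V i) j : i <> j -> single x j = 0.
Proof. by move=> ij; rewrite /= /single_fun; case: pselect. Qed.

Lemma single_linear i : linear (@single i).
Proof.
move=> a x y; apply: dsumP => j; rewrite -[RHS]/(a *: single x j + single y j).
have [<-|ij] := EM (i = j); first by rewrite !singleE.
by rewrite !singleN // scaler0 addr0.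
Qed.

Lemma single_act i (x : V i) y : act y (single x) = single (act y x).
Proof.
apply: dsumP => j; rewrite -[LHS]/(act y (single x j)).
have [<-|ij] := EM (i = j); first by rewrite !singleE.
by rewrite !singleN // linear0.
Qed.

Lemma dsum_ind (N : subspace (dsum V)) :
  (forall i (x : V i), N (single x)) -> forall u, N u.
Proof.
move=> Ns u.
have [s us] : exists s : seq {classic I}, forall i : {classic I}, u i <> 0 -> i \in s.
  have /(@finite_seqP {classic I})[s sE] := dsum_fin u; exists s => i ui.
  by have : [set` s]%classic i by rewrite -sE.
elim: s u us => [|i s IH] u us.
  suff -> : u = 0 by apply: subspace0.
  by apply: dsumP => i; apply: contrapT => /us.
rewrite -(subrK (single (u i)) u); apply: subspaceD => //; apply: IH => j.
rewrite -[(u - _) j]/(u j - single (u i) j).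
have [<-|ij] := EM (i = j); first by rewrite singleE subrr.
rewrite singleN // subr0 => /us; rewrite in_cons => /orP[/eqP ji|//].
by case: ij.
Qed.
End DirectSumTheory.

Section EmbeddingSum.
Context {K : numFieldType} {r n : int} {I : Type}.
Local Notation S := (zint r n).
Local Notation D := (degE (ind S) (interval r n) : glinf K).
Context (c : K) (A : I -> lieModType (@glS K S)) (V : I -> lieModType (glinf K)).
Context (io : forall i, A i -> V i) (emb : forall i, embeds c (@io i)).

Fact dsum_map_fin (u : dsum A) : finite_set (fun i => io (u i) <> 0).
Proof.
apply: sub_finite_set (dsum_fin u) => i ne ui; apply: ne.
by have [io_lin _ _ _ _] := emb i; rewrite ui (lin0 io_lin).
Qed.
Definition dsum_map (u : dsum A) : dsum V := Dsum (dsum_map_fin u).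

Lemma dsum_map_linear : linear dsum_map.
Proof. by move=> a u v; apply: dsumP => i; have [io_lin _ _ _ _] := emb i; apply: io_lin. Qed.

Lemma dsum_map_single i (a : A i) : dsum_map (single a) = single (io a).
Proof.
apply: dsumP => j; rewrite -[LHS]/(io (single a j)).
have [<-|ij] := EM (i = j); first by rewrite !singleE.
have [io_lin _ _ _ _] := emb j.
by rewrite !singleN // (lin0 io_lin).
Qed.

Lemma embeds_dsum : embeds c dsum_map.
Proof.
split.
- exact: dsum_map_linear.
- by move=> x u; apply: dsumP => i; have [_ io_act _ _ _] := emb i; apply: io_act.
- move=> u u0; apply: dsumP => i; have [_ _ io_inj _ _] := emb i; apply: io_inj.
  exact: (congr1 (fun v : dsum V => v i) u0).
- by move=> p q u qS; apply: dsumP => i; have [_ _ _ ioo _] := emb i; apply: ioo.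
- by move=> u; apply: dsumP => i; have [_ _ _ _ ioD] := emb i; apply: ioD.
Qed.

Lemma low_single i (x : V i) : low D c x -> low D c (single x).
Proof.
move: x; apply: span_ind => [|a x y lx ly|x [j Dx]].
- by rewrite (lin0 (@single_linear _ _ _ _ i)); apply: subspace0.
- by rewrite single_linear; apply: subspaceP.
apply: sub_span; exists j.
by rewrite single_act Dx (linZ (@single_linear _ _ _ _ i)).
Qed.

Lemma low_component (y : dsum V) i : low D c y -> low D c (y i).
Proof.
move: y; apply: span_ind => [|a x y lx ly|y [j Dy]].
- exact: subspace0.
- exact: subspaceP.
by apply: sub_span; exists j; apply: (congr1 (fun v : dsum V => v i) Dy).
Qed.

Hypothesis gr : forall i, graded c (@io i).

Lemma graded_dsum : graded c dsum_map.
Proof.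
pose P (v : dsum V) := exists u, low D c (v - dsum_map u).
have P0 : P 0.
  by exists 0; rewrite (lin0 dsum_map_linear) subr0; apply: subspace0.
have PD a v w : P v -> P w -> P (a *: v + w).
  move=> [u lu] [u' lu']; exists (a *: u + u').
  by rewrite dsum_map_linear opprD addrACA -scalerBr; apply: subspaceP.
apply: (@dsum_ind _ _ _ _ (Subspace P0 PD)) => i x.
have [a la] := gr x; exists (single a).
rewrite dsum_map_single -(linB (@single_linear _ _ _ _ i)).
exact: low_single.
Qed.

(** A submodule N may sit diagonally and miss every summand, so it is projected to V i instead of
    being intersected with it. If the projection of some z in N is io a, the top component of z lies
    in N by [low_extract] and therefore vanishes; then io a is both low and of degree c, hence
    zero. *)
Lemma tight_dsum : (forall i, tight (@io i)) -> tight dsum_map.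
Proof.
move=> tio; have [map_lin map_act map_inj mapo mapD] := embeds_dsum.
split=> N subN Nio.
  apply: dsum_ind => i.
  pose Q (x : V i) := N (single x).
  have Q0 : Q 0 by rewrite /Q (lin0 (@single_linear _ _ _ _ i)); apply: subspace0.
  have QD a x y : Q x -> Q y -> Q (a *: x + y).
    by rewrite /Q single_linear; apply: subspaceP.
  have [gen _] := tio i; apply: (gen (Subspace Q0 QD)) => [x y Qy|a].
    by rewrite /= /Q -single_act; apply: subN.
  by rewrite /= /Q -dsum_map_single.
move=> y Ny; apply: dsumP => i; apply: contrapT => yi.
pose Q (x : V i) := exists2 z, N z & z i = x.
have Q0 : Q 0 by exists 0; first exact: subspace0.
have QD a x x' : Q x -> Q x' -> Q (a *: x + x').
  by move=> [z Nz <-] [z' Nz' <-]; exists (a *: z + z'); first exact: subspaceP.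
have [_ meet] := tio i; apply: yi; apply: (meet (Subspace Q0 QD)).
- by move=> x _ [z Nz <-]; exists (act x z); first exact: subN.
- move=> a [z Nz za]; have [u lu] := graded_dsum z.
  have Nu : N (dsum_map u).
    apply: (low_extract _ (mapD u) lu) => [v|]; first exact: subN.
    by rewrite addrC subrK.
  have lz : low D c z by rewrite -[z]subr0 -(lin0 map_lin) -(Nio u Nu).
  have [_ _ io_inj _ ioD] := emb i; apply: io_inj.
  by apply: low_eig0 (ioD a) _; rewrite -za; apply: low_component.
by exists y.
Qed.
End EmbeddingSum.

(** * Tensor products *)

Lemma roomy_seq (T : {pred int}) (t : seq int) d :
  uniq t -> {subset t <= T} -> (d <= size t)%N -> roomy T d.
Proof.
move=> ut tT dt s sd; apply: contrapT => none.
suff : (size t <= size s)%N by lia.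
apply: uniq_leq_size => // m mt; apply: contrapT => /negP ms.
by apply: none; exists m; first exact: tT.
Qed.

Lemma roomy_interval (r n : int) d : r <= n -> r + d%:Z <= n + 1 -> roomy (zint r n) d.
Proof.
move=> rn rdn; apply: (@roomy_seq _ (interval r n)); first exact: interval_uniq.
  by move=> i; rewrite mem_interval.
by rewrite size_map size_iota; lia.
Qed.

Section TensorCyclic.
Context {K : numFieldType} {r n : int}.
Local Notation S := (zint r n).

(* Move w away from S, to a vector y whose weight is supported in {n+1, ...}.
   The E_{p,q} with q > n kill v and generate W from y, and therefore generate
   all of v (x) W from v (x) y. *)
Lemma tensor_cyclic d (f g : int -> K) (V W : lieModType (glinf K)) (v : V) (w : W) :
  irreducible_module V -> irreducible_module W -> hwvec S f v -> hwvec S g w ->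
  polymod d W -> cyclic_module (tensor V W).
Proof.
move=> irrV irrW [v0 _ nv] [w0 gw _] polyW.
pose T : {pred int} := [pred i | n < i].
have roomT : roomy T d.
  apply: (@roomy_seq _ [seq n + 1 + i%:Z | i <- iota 0 d]).
  - by rewrite map_inj_uniq ?iota_uniq // => i j; lia.
  - by move=> _ /mapP[i _ ->]; rewrite inE /=; lia.
  - by rewrite size_map size_iota.
have [s sd sE] := weight_is_wt polyW w0 gw.
have sw : wt s w by move=> i; rewrite gw sE.
have [||y [t [_ y0 td ty tT]]] :=
  @move_meet _ _ _ polyW _ roomT (im_sub (@linear_id K W)) s w _ sw sd _ w0.
- by move=> x u _; exists (act x u).
- by exists w.
pose A (x : glinf K) := exists p q, x = gE p q /\ q \in T.
pose B (x : glinf K) := exists p q, x = gE p q /\ q \notin T.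
have AB x : span (fun y => A y \/ B y) x.
  elim/(@gl_ind K): x => [|a x x'|p q]; first exact: subspace0.
    exact: subspaceP.
  apply: sub_span; have [qT|qT] := boolP (q \in T); last by right; exists p, q.
  by left; exists p, q.
have clW x : closure A (line y) x.
  apply: (irreducible_submodule_full irrW _ _ y0); last first.
    by apply: sub_closure; exists 1; rewrite scale1r.
  apply: (closure_submodule AB) => _ _ [p [q [-> qT]]] [a ->].
  have := wt_gE p q polyW ty; rewrite ifF => [y1|]; last first.
    by apply: contraNF qT => /(allP tT).
  by exists 0; rewrite linearZ_LR /= y1 scaler0 scale0r.
exists (tensor_pure v y) => N subN Nvy.
have Nv x : N (tensor_pure v x).
  move: x (clW x); apply: closure_ind => [|a x x'|_ [a ->]|_ x [p [q [-> qT]]] Nx].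
  - by rewrite pure0r; apply: subspace0.
  - by rewrite tensor_pureDr; apply: subspaceP.
  - by rewrite pureZr; apply: subspaceZ.
  have := subN (gE p q) _ Nx; rewrite act_pure nv ?pure0l ?add0r // /nilrel.
  by move: qT; rewrite /zint !inE => qT; rewrite (_ : (r <= q <= n) = false) //; lia.
pose Q x := forall x', N (tensor_pure (x : V) (x' : W)).
have Q0 : Q 0 by move=> x'; rewrite pure0l; apply: subspace0.
have QD a x x' : Q x -> Q x' -> Q (a *: x + x').
  by move=> Qx Qx' z; rewrite tensor_pureDl; apply: subspaceP.
(* The x with x (x) W inside N form a submodule of V, because x' (u (x) z) - u (x) x' z = x' u (x)
   z; it contains v. *)
have Qall : forall x, Q x.
  apply: (@irreducible_submodule_full _ V v (Subspace Q0 QD) irrV _ Nv v0) => x u Qu z.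
  have := subspaceB (subN x _ (Qu z)) (Qu (act x z)).
  by rewrite act_pure addrK.
apply: (@tensor_ind _ _ V W) => [|a x x'|x x']; first exact: subspace0.
  exact: subspaceP.
exact: Qall.
Qed.
End TensorCyclic.

Section Truncation.
Context {K : numFieldType} {r n : int} (rn : r <= n).
Local Notation S := (zint r n).
Local Notation DS := (degS S (ind S) (interval r n) : @glS K S).

Lemma irreducible_embedding (nu : weight K) (A : lieModType (@glS K S))
    (V : lieModType (glinf K)) (v : V) :
  is_irr_gl nu A -> irreducible_module V -> hwvec S (weight_at nu) v ->
  exists (c : K) (io : A -> V), [/\ embeds c io, graded c io & tight io].
Proof.
move=> [irrA [a0 [a0_neq0 na ha _]]] irrV hv.
have [|p q pS qS pq|c [io emb]] :=
    embeds_exists rn irrA irrV hv a0_neq0.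
- move=> i iS; rewrite (ha (unitS S i i) (hE i)) //.
  by rewrite val_unitS.
- by apply: na; rewrite val_unitS //; apply: glspan_E.
have tio := irreducible_tight emb irrV a0_neq0.
by exists c, io; split=> //; apply: (generated_graded rn emb); case: tio.
Qed.

Lemma lie_iso_DS (c : K) (A B : lieModType (@glS K S)) : lie_iso A B ->
  (forall a : A, act DS a = c *: a) -> forall b : B, act DS b = c *: b.
Proof.
move=> [phi [[phi_lin phi_act] [psi phiK psiK]]] DA b.
by rewrite -[b]psiK -phi_act DA (linZ phi_lin).
Qed.

Lemma tensor_iso_dsum d e (lambda mu : weight K) (A B : lieModType (@glS K S))
    (V W : lieModType (glinf K)) (v : V) (w : W) (I : Type) (nu : I -> weight K)
    (N : I -> lieModType (@glS K S)) (N' : I -> lieModType (glinf K)) :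
  is_irr_gl lambda A -> irreducible_module V -> hwvec S (weight_at lambda) v ->
  is_irr_gl mu B -> irreducible_module W -> hwvec S (weight_at mu) w ->
  polymod d V -> polymod e W -> roomy S (d + e) ->
  (forall i, {subset supp (nu i) <= S}) -> (forall i, is_irr_gl (nu i) (N i)) ->
  (forall i, is_L S (nu i) (N' i)) ->
  lie_iso (tensor A B) (dsum N) -> lie_iso (tensor V W) (dsum N').
Proof.
move=> irrA irrV hv irrB irrW hw polyV polyW roomS suppS irrN LN' iso.
have nz (M : lieModType (@glS K S)) nu' : is_irr_gl nu' M -> exists a : M, a <> 0.
  by move=> [[]].
have [c [io [emb gr _]]] := irreducible_embedding irrA irrV hv.
have [c' [io' [emb' gr' _]]] := irreducible_embedding irrB irrW hw.
have [[a a0] [b b0]] := (nz _ _ irrA, nz _ _ irrB).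
move: emb gr emb' gr'.
move=> /[dup] emb; rewrite (embeds_degree rn emb polyV a0) => {}emb gr.
move=> /[dup] emb'; rewrite (embeds_degree rn emb' polyW b0) => {}emb' gr'.
have [io2] := embeds_tensor emb gr emb' gr'; rewrite -natrD => emb2 gr2.
have tio2 := polymod_tight rn emb2 gr2 (polymod_tensor polyV polyW) roomS.
(* The grading operator belongs to gl_S, so its scalar d + e is carried across the isomorphism. This
   gives all the embeddings of the N i a common degree, as the direct sum of embeddings requires. *)
have DN : forall u : dsum N, act DS u = (d + e)%:R *: u.
  by apply: (lie_iso_DS iso) => u; apply: (act_DS rn u emb2).
have exN i : exists io : N i -> N' i,
    [/\ embeds (d + e)%:R io, graded (d + e)%:R io & tight io].
  have [irrN' [x hx]] := is_L_hwvec (suppS i) (LN' i).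
  have [ci [ioi [embi gri ti]]] := irreducible_embedding (irrN i) irrN' hx.
  suff ciE : ci = (d + e)%:R by exists ioi; rewrite -ciE.
  have [x0 x0_neq0] := nz _ _ (irrN i).
  have := congr1 (fun u : dsum N => u i) (DN (single x0)).
  rewrite -[LHS]/(act DS (single x0 i)) -[RHS]/((d + e)%:R *: single x0 i) singleE.
  rewrite (act_DS rn x0 embi) => /eqP.
  by rewrite -subr_eq0 -scalerBl scaler_eq0 subr_eq0 => /orP[/eqP//|/eqP].
pose ioN i := projT1 (cid (exN i)).
have ioNP i : [/\ embeds (d + e)%:R (ioN i), graded (d + e)%:R (ioN i) & tight (ioN i)].
  by rewrite /ioN; case: (cid _).
have embN i : embeds (d + e)%:R (ioN i) by case: (ioNP i).
apply: (embeds_iso rn emb2 (embeds_dsum embN) tio2 _ iso).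
by apply: tight_dsum => i; case: (ioNP i).
Qed.
End Truncation.

Lemma Pplus_nat (K : numFieldType) (S : {pred int}) (lambda : weight K) :
  Pplus S lambda -> exists f : int -> nat,
  [/\ forall i, weight_at lambda i = (f i)%:R, forall i, i \notin S -> f i = 0%N
    & forall i j, i \in S -> j \in S -> i < j -> (f j <= f i)%N].
Proof.
move=> [nat0 out dec]; pose f i := projT1 (cid (nat0 i)).
have fE i : weight_at lambda i = (f i)%:R by rewrite /f; case: (cid _).
exists f; split=> // [i /out|i j iS jS /(dec i j iS jS)].
  by rewrite fE => /eqP; rewrite pnatr_eq0 => /eqP.
by rewrite !fE ler_nat.
Qed.

Lemma is_L_polymod (K : numFieldType) (r n : int) (lambda : weight K) : r <= n ->
  Pplus (zint r n) lambda ->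
  exists d, forall V : lieModType (glinf K), is_L (zint r n) lambda V ->
  [/\ irreducible_module V, exists v : V, hwvec (zint r n) (weight_at lambda) v
    & polymod d V].
Proof.
move=> rn dom; have [f [fE f0 f_dec]] := Pplus_nat dom.
have [d dP] := irreducible_polymod rn (hwmodel_dominant (K := K) rn f0 f_dec).
have suppS : {subset supp lambda <= zint r n}.
  by move=> i; rewrite inE fE pnatr_eq0; apply: contraNT => /f0/eqP.
exists d => V /(is_L_hwvec suppS)[irrV [v hv]]; split=> //; first by exists v.
apply: (dP V v irrV); case: hv => v0 fv nv; split=> // i.
by rewrite fv fE.
Qed.

(** The units that come into play for the larger interval have their column outside {r, ..., n} and
    already kill v. Thus L(S, lambda) also serves as the module with highest weight lambda for the
    larger interval. *)
Lemma hwvec_widen (K : numFieldType) (r n m : int) (f : int -> K)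
    (V : lieModType (glinf K)) (v : V) :
  n <= m -> hwvec (zint r n) f v -> hwvec (zint r m) f v.
Proof.
move=> nm [v0 fv nv]; split=> // p q pq; apply: nv; move: pq.
by rewrite /nilrel /zint !inE; lia.
Qed.

Theorem theorem4p4 (R : realType) (r n : int) (hrn : r <= n)
    (lambda mu : weight R[i])
    (hlambda : Pplus (zint r n) lambda) (hmu : Pplus (zint r n) mu) :
  (forall V W : lieModType (glinf R[i]),
     is_L (zint r n) lambda V -> is_L (zint r n) mu W ->
     cyclic_module (tensor V W)) /\
  (exists k : int, n <= k /\
     forall nbar : int, k <= nbar ->
     forall A B : lieModType (@glS R[i] (zint r nbar)),
       is_irr_gl lambda A -> is_irr_gl mu B ->
     forall (I : Type) (nu : I -> weight R[i])
       (N : I -> lieModType (@glS R[i] (zint r nbar))),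
       (forall alpha, {subset supp (nu alpha) <= zint r nbar}) ->
       (forall alpha, is_irr_gl (nu alpha) (N alpha)) ->
       lie_iso (tensor A B) (dsum N) ->
     forall V W : lieModType (glinf R[i]),
       is_L (zint r n) lambda V -> is_L (zint r n) mu W ->
     forall N' : I -> lieModType (glinf R[i]),
       (forall alpha, is_L (zint r nbar) (nu alpha) (N' alpha)) ->
       lie_iso (tensor V W) (dsum N')).
Proof.
have [d dP] := is_L_polymod hrn hlambda.
have [e eP] := is_L_polymod hrn hmu.
split=> [V W /dP[irrV [v hv] _] /eP[irrW [w hw] polyW]|].
  exact: tensor_cyclic irrV irrW hv hw polyW.
(* With r <= n, the interval from r to any m >= n + d + e has at least d + e elements, as many as
   there are letters in a weight of the tensor product. *)
exists (n + (d + e)%:Z); split=> [|m km A B irrA irrB I nu N suppS irrN iso]; first by lia.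
move=> V W /dP[irrV [v hv] polyV] /eP[irrW [w hw] polyW] N' LN'.
have [rm nm] : r <= m /\ n <= m by lia.
apply: (tensor_iso_dsum rm irrA irrV (hwvec_widen nm hv) irrB irrW
  (hwvec_widen nm hw) polyV polyW _ suppS irrN LN' iso).
by apply: roomy_interval => //; lia.
Qed.
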